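(* There exists an infinite skew-symmetric matrix $A=[a_{i,j}]_{i,j\ge 1}$ with integer entries such that for every integer $n\ge 1$ and every set $I=\{i_1,\dots,i_r\}$ with $1\le i_1<\dots<i_r\le n$ ($r\ge 1$), $$|O(n;I)|=\operatorname{pf}(A_I),$$ where $A_I$ is the $r\times r$ matrix obtained from $A$ by selecting the rows and columns indexed by $I$.
   Context: Aztec diamond: $AD(n)$ is the union of the closed unit squares $[a,a+1]\times[b,b+1]$ ($a,b\in\mathbb{Z}$) with $|a+\tfrac12|+|b+\tfrac12|\le n$; we refer to such a square by its lower-left corner $(a,b)$. Color the square $(a,b)$ black if $a+b\equiv n-1 \pmod 2$ and white otherwise. A domino tiling is a covering of a region by dominoes (unions of two unit squares sharing an edge) without gaps or overlaps. For $i=1,\dots,n$, the $i$-th diagonal cell is the $2\times 2$ block of the four unit squares with lower-left corners $(-1,2i-n-2),(0,2i-n-1)$ (both black) and $(-1,2i-n-1),(0,2i-n-2)$ (both white); a domino is completely contained in the cell if both its squares are among these four. For $\ell=1,\dots,n$, the $\ell$-th square of the southwestern boundary is the square $(-\ell,\ell-n-1)$, and its mirror image under the reflection $x\mapsto -x$ is the square $(\ell-1,\ell-n-1)$ on the southeastern boundary. For $I\subseteq\{1,\dots,n\}$, let $R(n;I)$ be the region obtained from $AD(n)$ by removing, for every $\ell\in\{1,\dots,n\}\setminus I$, the $\ell$-th southwestern boundary square and its mirror image. $O(n;I)$ is the set of domino tilings of $R(n;I)$ that are invariant under the reflection $x\mapsto -x$ and in which each of the $n$ diagonal cells contains exactly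 one complete domino (off-diagonally symmetric tilings). Pfaffian: for a $2m\times 2m$ skew-symmetric matrix $M$, $\operatorname{pf}(M)=\sum_{\sigma}\operatorname{sgn}(\sigma)\prod_{k=1}^m M_{\sigma_{2k-1},\sigma_{2k}}$, summed over perfect matchings $\{(\sigma_1,\sigma_2),\dots,(\sigma_{2m-1},\sigma_{2m})\}$ of $\{1,\dots,2m\}$ with $\sigma_{2k-1}<\sigma_{2k}$ and $\sigma_1<\sigma_3<\dots<\sigma_{2m-1}$, where $\operatorname{sgn}(\sigma)$ is the sign of the permutation $k\mapsto\sigma_k$. The Pfaffian of a skew-symmetric matrix of odd order is taken to be $0$. *)

(* Defs.v *)
From mathcomp Require Import all_boot all_order all_fingroup all_algebra.
From mathcomp Require Import finmap zify.
Set Implicit Arguments.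
Unset Strict Implicit.
Unset Printing Implicit Defensive.

Import Order.TTheory GRing.Theory Num.Theory.
Local Open Scope fset_scope.
Local Open Scope ring_scope.

                                                                            
Notation square := (int * int)%type.

                                                                
Definition aztec_cond (n : nat) (q : square) : bool :=
  `|2 * q.1 + 1| + `|2 * q.2 + 1| <= 2 * n%:Z.

                                                                                
Definition int_range (n : nat) : seq int :=
  [seq k%:Z - n%:Z | k <- iota 0 (n + n)].

Definition aztec (n : nat) : {fset square} :=
  [fset q in [seq (a, b) | a <- int_range n, b <- int_range n] | aztec_cond n q].

                                                          
Definition mirror (q : square) : square := (- q.1 - 1, q.2).

Definition sw_square (n l : nat) : square := (- l%:Z, l%:Z - n%:Z - 1).

Definition removed (n : nat) (s : seq nat) : {fset square} :=
  [fset sw_square n l | l in [seq l <- iota 1 n | l \notin s]]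
  `|` [fset mirror (sw_square n l) | l in [seq l <- iota 1 n | l \notin s]].

Definition region (n : nat) (s : seq nat) : {fset square} :=
  aztec n `\` removed n s.

Definition adjacent (p q : square) : bool :=
  `|p.1 - q.1| + `|p.2 - q.2| == 1.

Definition is_domino (D : {fset square}) : bool :=
  [exists p : D, exists q : D,
     adjacent (val p) (val q) && (D == [fset val p; val q])].

Definition is_tiling (R : {fset square}) (T : {fset {fset square}}) : bool :=
  [&& [forall D : T, is_domino (val D)], trivIfset T & fcover T == R].

Definition reflection_invariant (T : {fset {fset square}}) : bool :=
  [fset [fset mirror q | q in (D : {fset square})] | D in T] == T.

Definition diag_cell (n i : nat) : {fset square} :=
  [fset (- 1, 2 * i%:Z - n%:Z - 2); (0, 2 * i%:Z - n%:Z - 1);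
        (- 1, 2 * i%:Z - n%:Z - 1); (0, 2 * i%:Z - n%:Z - 2)].

Definition off_diagonal (n : nat) (T : {fset {fset square}}) : bool :=
  all (fun i => #|` [fset D in T | D `<=` diag_cell n i]| == 1%N) (iota 1 n).

                                                                                
Definition off_tilings (n : nat) (s : seq nat) : {fset {fset {fset square}}} :=
  [fset T in fpowerset (fpowerset (region n s))
     | [&& is_tiling (region n s) T, reflection_invariant T & off_diagonal n T]].

                                                                                  
                                                                              
Definition is_pf_matching (r : nat) (s : 'S_r) : bool :=
  [forall i : 'I_r, forall j : 'I_r,
     (~~ odd i && (j == i.+1 :> nat)) ==> (s i < s j)%N] &&
  [forall i : 'I_r, forall j : 'I_r,
     [&& ~~ odd i, ~~ odd j & (i < j)%N] ==> (s i < s j)%N].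

Definition pf (R : comNzRingType) (r : nat) (M : 'M[R]_r) : R :=
  if odd r then 0
  else \sum_(s : 'S_r | is_pf_matching s)
         (-1) ^+ s *
         \prod_(p : 'I_r * 'I_r | ~~ odd p.1 && (p.2 == p.1.+1 :> nat))
            M (s p.1) (s p.2).

Definition principal_sub (A : nat -> nat -> int) (s : seq nat) : 'M[int]_(size s) :=
  \matrix_(k < size s, l < size s) A (nth 0%N s k) (nth 0%N s l).

Lemma in_aztec (n : nat) (q : square) : (q \in aztec n) = aztec_cond n q.
Proof.
rewrite /aztec !inE /=; case: (boolP (aztec_cond n q)) => [h|]; rewrite ?andbF //.
rewrite andbT; case: q h => a b; rewrite /aztec_cond /= => h.
have range (c : int) : `|2 * c + 1| <= 2 * n%:Z -> c \in int_range n.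
  rewrite ler_norml => /andP[h1 h2].
  have c1 : 0 <= c + n%:Z by lia.
  apply/mapP; exists (absz (c + n%:Z)); last by rewrite gez0_abs // addrK.
  by rewrite mem_iota; lia.
apply: allpairs_f; apply: range; apply: le_trans h.
- by rewrite lerDl.
- by rewrite lerDr.
Qed.

Lemma mirror_sw_square (n l : nat) :
  mirror (sw_square n l) = (l%:Z - 1, l%:Z - n%:Z - 1).
Proof. by rewrite /mirror /= opprK. Qed.

Lemma is_dominoP (D : {fset square}) :
  reflect (exists p q : square, adjacent p q /\ D = [fset p; q]) (is_domino D).
Proof.
apply: (iffP existsP) => [[p /existsP[q /andP[pq /eqP DE]]]|[p [q [pq DE]]]].
  by exists (val p), (val q).
have pD : p \in D by rewrite DE !inE eqxx.
have qD : q \in D by rewrite DE !inE eqxx orbT.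
by exists [` pD]; apply/existsP; exists [` qD]; rewrite /= pq; apply/eqP.
Qed.

Lemma in_off_tilings (n : nat) (s : seq nat) (T : {fset {fset square}}) :
  (T \in off_tilings n s) =
  [&& is_tiling (region n s) T, reflection_invariant T & off_diagonal n T].
Proof.
rewrite /off_tilings !inE /=; apply: andb_idl => /and3P[/and3P[_ _ /eqP cT] _ _].
rewrite fpowersetE; apply/fsubsetP => D DT; rewrite fpowersetE -cT.
exact: bigfcup_sup.
Qed.

(* Main.v *)
(** By symmetry a tiling is determined by its left half.  There, let row [i] consist of
    the black squares on the antidiagonal issued from the [i]-th diagonal cell and of the
    white squares just above them.  Regard the black squares matched upwards or to the
    right as particles.  Within a row each particle jumps by 0 or 1 towards the axis (or
    is absorbed by the centre), and the positions of the particles of the next row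
    interlace the positions so reached.  None of this depends on [n].

    Both moves are multilinear: summing an alternating multilinear functional over them
    amounts to applying a linear map to each argument, since collisions contribute
    nothing.  The central cell acts as the sum of the creation of a particle at the
    innermost position and of the absorption of one, and the interlacing move contracts
    with the functional sending every basis vector to 1.  Consequently, if [a] is an
    alternating form with [a 0 t = 2] for [t > 0], and with [a s t] equal to the value
    of [a] on the images of [s] and [t] under one round of moves for [s, t > 0], then
    the Pfaffian of [a] satisfies the recursion of the number of tilings: without a
    particle at 0 this is multilinearity, with one it is the expansion along the first
    row. *)

Require Import Defs.
From mathcomp Require Import all_boot all_order all_fingroup all_algebra.
From mathcomp Require Import finmap.
From mathcomp Require Import zify ring.
Set Implicit Arguments.
Unset Strict Implicit.
Unset Printing Implicit Defensive.
Import Order.TTheory GRing.Theory Num.Theory.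
Local Open Scope ring_scope.

(** * Pfaffians of sequences of vectors *)

Section Contraction.
Variables (R : comNzRingType) (T : Type).
Implicit Types (c : T -> R) (G : seq T -> R) (B : T -> T -> R) (w : seq T).

(** The interior product of [c] and [G]: each entry in turn is deleted and fed to [c], with
    alternating signs. [contractE] is the closed form. *)
Fixpoint contract c G w : R :=
  if w is x :: w' then c x * G w' - contract c (fun u => G (x :: u)) w' else 0.

Lemma contract_cons c G x w :
  contract c G (x :: w) = c x * G w - contract c (fun u => G (x :: u)) w.
Proof. by []. Qed.

Lemma eq_contract c c' G G' w :
    (forall x, c x = c' x) ->
    (forall u, size u = (size w).-1 -> G u = G' u) ->
  contract c G w = contract c' G' w.
Proof.
move=> ec; elim: w G G' => // x [|y w] IH G G' eG; first by rewrite /= ec eG.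
rewrite (contract_cons _ G) (contract_cons _ G') ec eG //; congr (_ - _).
by apply: IH => u us; apply: (eG (x :: u)); rewrite /= us.
Qed.

Lemma contract0 c w : contract c (fun=> 0) w = 0.
Proof. by elim: w => //= x w ->; rewrite mulr0 subr0. Qed.

Lemma contractD c G G' w :
  contract c (fun u => G u + G' u) w = contract c G w + contract c G' w.
Proof. by elim: w G G' => [|x w IH] G G' /=; rewrite ?addr0 // IH; ring. Qed.

Lemma contractB c G G' w :
  contract c (fun u => G u - G' u) w = contract c G w - contract c G' w.
Proof. by elim: w G G' => [|x w IH] G G' /=; rewrite ?subr0 // IH; ring. Qed.

Lemma contractZ c a G w :
  contract c (fun u => a * G u) w = a * contract c G w.
Proof. by elim: w G => [|x w IH] G /=; rewrite ?mulr0 // IH; ring. Qed.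

(** Two entries can be deleted in either order, with opposite signs. For [c := B v] this cancels the
    terms in which two copies of [v] have different partners. *)
Lemma contract_contract c G w : contract c (contract c G) w = 0.
Proof.
elim: w G => //= x w IH G.
by rewrite contractB contractZ IH subr0 subrr.
Qed.

Lemma contractE c G x0 w :
  contract c G w =
  \sum_(k < size w) (-1) ^+ k * c (nth x0 w k) * G (take k w ++ drop k.+1 w).
Proof.
elim: w G => [|x w IH] G /=; first by rewrite big_ord0.
rewrite big_ord_recl /= expr0 mul1r drop0 IH -sumrN; congr (_ + _).
by apply: eq_bigr => k _; rewrite /bump leq0n add1n exprS /=; ring.
Qed.

Definition alternating G := forall s1 s2 v, G (s1 ++ v :: v :: s2) = 0.

(** Deleting one or the other copy of [v] gives opposite terms; any other deletion leaves the two
    copies adjacent. *)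
Lemma contract_alternating c G : alternating G -> alternating (contract c G).
Proof.
move=> aG s1 s2 v; elim: s1 G aG => [|x s1 IH] G aG /=.
  rewrite (@eq_contract c c _ (fun=> 0) s2) ?contract0 => [||u _] //.
    by rewrite subr0 subrr.
  exact: (aG [::]).
by rewrite aG mulr0 IH ?subrr // => t1 t2 u; apply: (aG (x :: t1)).
Qed.

(** Expansion along the first row. The fuel [N] is there because the recursive call is applied to
    lists that are not subterms of [w]. *)
Fixpoint pfaffian_rec B N w : R :=
  if w is x :: w' then
    if N is N'.+1 then contract (B x) (pfaffian_rec B N') w' else 0
  else 1.

Definition pfaffian B w := pfaffian_rec B (size w) w.

Lemma pfaffian_recE B N w : (size w <= N)%N -> pfaffian_rec B N w = pfaffian B w.
Proof.
suff rE M : (size w <= M)%N -> (size w <= N)%N ->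
    pfaffian_rec B N w = pfaffian_rec B M w by exact: rE.
elim: N M w => [|N IH] [|M] [|x w] //= sM sN; apply: eq_contract => // u us.
by apply: IH; rewrite us (leq_trans (leq_pred _)).
Qed.

Lemma pfaffian_cons B x w : pfaffian B (x :: w) = contract (B x) (pfaffian B) w.
Proof.
by apply: eq_contract => // u us; apply: pfaffian_recE; rewrite us leq_pred.
Qed.

Lemma eq_pfaffian B B' w :
  (forall x y, B x y = B' x y) -> pfaffian B w = pfaffian B' w.
Proof.
rewrite /pfaffian => eB; move: (size w) => N.
by elim: N w => [|N IH] [|x w] //=; apply: eq_contract.
Qed.

Lemma pfaffian_alternating B : (forall x, B x x = 0) -> alternating (pfaffian B).
Proof.
move=> B0; suff aN N : alternating (pfaffian_rec B N) by move=> *; apply: aN.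
elim: N => [|N IH] [|x s1] s2 v //=; last exact: contract_alternating.
rewrite B0 mul0r; case: N {IH} => [|N] /=; first by rewrite contract0 subrr.
by rewrite contract_contract subrr.
Qed.

End Contraction.

Lemma contract_map (R : comNzRingType) (T U : Type) (f : T -> U) (c : U -> R) G w :
  contract c G (map f w) = contract (fun x => c (f x)) (fun u => G (map f u)) w.
Proof. by elim: w G => //= x w IH G; rewrite IH. Qed.

Lemma pfaffian_map (R : comNzRingType) (T U : Type) (f : T -> U) (B : U -> U -> R) w :
  pfaffian B (map f w) = pfaffian (fun x y => B (f x) (f y)) w.
Proof.
move: {2}(size w) (leqnn (size w)) => N; elim: N w => [|N IH] [|x w] //= sN.
rewrite !pfaffian_cons contract_map; apply: eq_contract => // u us.
by apply: IH; rewrite us (leq_trans (leq_pred _)).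
Qed.

Section Multiadditive.
Variables (R : comNzRingType) (V : zmodType).
Implicit Types (G : seq V -> R) (B : V -> V -> R) (w : seq V).

Definition additive_fun (W : zmodType) (c : V -> W) := forall u v, c (u + v) = c u + c v.

Definition multiadditive G := forall s1 s2 u v,
  G (s1 ++ (u + v) :: s2) = G (s1 ++ u :: s2) + G (s1 ++ v :: s2).

Lemma additive_fun0 (W : zmodType) (c : V -> W) : additive_fun c -> c 0 = 0.
Proof. by move=> ac; apply: (addrI (c 0)); rewrite -ac !addr0. Qed.

Lemma multiadditive0 G s1 s2 : multiadditive G -> G (s1 ++ 0 :: s2) = 0.
Proof. by move=> mG; apply: (addrI (G (s1 ++ 0 :: s2))); rewrite -mG !addr0. Qed.

Lemma contract_multiadditive (c : V -> R) G :
  additive_fun c -> multiadditive G -> multiadditive (contract c G).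
Proof.
move=> ac mG s1 s2 u v; elim: s1 G mG => [|x s1 IH] G mG /=.
  rewrite ac (@eq_contract _ _ c c _ (fun t => G (u :: t) + G (v :: t))) //.
    by rewrite contractD; ring.
  by move=> t _; apply: (mG [::]).
rewrite mG IH; first by ring.
by move=> t1 t2 a b; apply: (mG (x :: t1)).
Qed.
End Multiadditive.

Lemma pfaffian_multiadditive (R : comNzRingType) (V : zmodType) (B : V -> V -> R) :
    (forall u, additive_fun (B u)) -> (forall v, additive_fun (B^~ v)) ->
  multiadditive (pfaffian B).
Proof.
move=> Br Bl.
(* Contraction preserves multiadditivity of functions on all lists, while the induction only
   controls short ones; truncating by length reconciles the two. *)
suff mN N : multiadditive (fun w => if (size w <= N)%N then pfaffian B w else 0).
  move=> s1 s2 u v; have := mN (size (s1 ++ u :: s2)) s1 s2 u v.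
  by rewrite !size_cat /= leqnn.
elim: N => [|N IH] [|x s1] s2 u v //=; rewrite ?addr0 ?size_cat //.
  case: ifP => [sN|]; last by rewrite addr0.
  rewrite !pfaffian_cons; elim: s2 (pfaffian B) {sN IH} => [|x s2 IH] G /=.
    by rewrite addr0.
  by rewrite Bl IH; ring.
case: ifP => [sN|]; last by rewrite addr0.
rewrite /= ltnS in sN; rewrite !pfaffian_cons.
have eG w : size w = (size (s1 ++ u :: s2)).-1 ->
    pfaffian B w = if (size w <= N)%N then pfaffian B w else 0.
  by move=> sw; rewrite sw size_cat (leq_trans (leq_pred _)).
rewrite !(@eq_contract _ _ _ _ (pfaffian B) _ _ (fun=> erefl) eG).
have := contract_multiadditive (Br x) IH s1 s2 u v.
have ec y : contract (B x) (fun w => if (size w <= N)%N then pfaffian B w else 0) (s1 ++ y :: s2)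
         = contract (B x) (pfaffian B) (s1 ++ y :: s2).
  apply: eq_contract => // w sw; rewrite ifT // sw size_cat.
  by rewrite (leq_trans (leq_pred _)).
by rewrite !ec.
Qed.

(** * Sums over the moves of the particles *)

(* The direction of the partner of a black square [q] is coded by a pair: (true, true) is
   up, (true, false) right, (false, true) down, (false, false) left.  So the first
   component tells whether [q] carries a particle; if so, the second one tells whether
   the particle stays at its position. *)
Notation dir := (bool * bool)%type.
Notation dirs := [:: (true, true); (true, false); (false, true); (false, false)].

Fixpoint words (T : Type) (A : seq T) (m : nat) : seq (seq T) :=
  if m is m'.+1 then [seq d :: r | d <- A, r <- words A m'] else [:: [::]].

Lemma big_words (R : comNzRingType) (T : Type) (A : seq T) m (F : seq T -> R) :
  \sum_(r <- words A m.+1) F r = \sum_(d <- A) \sum_(r <- words A m) F (d :: r).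
Proof. by rewrite /= big_allpairs_dep. Qed.

Lemma mem_words (T : eqType) (A : seq T) m r :
  (r \in words A m) = (size r == m) && all (mem A) r.
Proof.
elim: m r => [|m IH] [|d r] //=.
  by apply/allpairsP => -[[a b] []].
rewrite eqSS andbCA -IH; apply/allpairsP/andP => [[[a b] /= [aA bw [-> ->]]]|[dA rw]] //.
by exists (d, r).
Qed.

Lemma words_uniq (T : eqType) (A : seq T) m : uniq A -> uniq (words A m).
Proof.
move=> uA; elim: m => //= m IH; apply: allpairs_uniq => //.
by move=> [a b] [c d] _ _ /= [-> ->].
Qed.

(* [P] marks the white squares of a row already matched, [r] is the next row, and [pend]
   tells that the first white square is the left neighbour of a black square preceding
   [r].  Every white square has to be hit exactly once. *)
Fixpoint covers (pend : bool) (P : seq bool) (r : seq dir) : bool :=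
  if P is p :: P' then
    if r is d :: r' then
      ~~ (pend && p) &&
      (if pend || p then (d != (false, true)) && covers (~~ d.1) P' r'
       else (d == (false, true)) && covers false P' r')
    else nilp P' && (pend != p)
  else false.

(* The particle pattern of the row [r] in [covers]: the directions of the other black
   squares are forced. *)
Fixpoint interlaces (pend : bool) (P : seq bool) (s : seq bool) : bool :=
  if P is p :: P' then
    if s is b :: s' then
      ~~ (pend && p) &&
      (if pend || p then interlaces (~~ b) P' s' else ~~ b && interlaces false P' s')
    else nilp P' && (pend != p)
  else false.

Fixpoint positions (k : nat) (s : seq bool) : seq nat :=
  if s is b :: s' then
    if b then k :: positions k.+1 s' else positions k.+1 s'
  else [::].

Fixpoint row_vectors (V : Type) (z : nat -> V) (k : nat) (r : seq dir) : seq V :=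
  if r is d :: r' then
    if d.1 then (if d.2 then z k else z k.-1) :: row_vectors z k.+1 r'
    else row_vectors z k.+1 r'
  else [::].

(** [own] tells that the white square to the right of the first square of [r] is already matched
    with the black square below it. *)
Fixpoint no_collision (own : bool) (r : seq dir) : bool :=
  if r is d :: r' then
    ~~ (own && (d == (true, false))) && no_collision (d == (true, true)) r'
  else true.

Fixpoint occupied (own : bool) (r : seq dir) : seq bool :=
  if r is d :: r' then
    (own || (d == (true, false))) :: occupied (d == (true, true)) r'
  else [:: own].

Section Rows.
Variables (R : comNzRingType) (V : zmodType).
Implicit Types (H : seq V -> R) (z e : nat -> V).

(** The rows are grouped by particle pattern. [covers] does not see whether a particle stays or
    jumps and forces all other directions, so multiadditivity merges the two choices of each
    particle. *)
Lemma sum_covers H z m pend P k w : multiadditive H ->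
  \sum_(r <- words dirs m) (covers pend P r)%:R * H (w ++ row_vectors z k r) =
  \sum_(s <- words [:: true; false] m) (interlaces pend P s)%:R *
     H (w ++ [seq z x + z x.-1 | x <- positions k s]).
Proof.
move=> mH; elim: m pend P k w => [|m IH] pend P k w.
  by rewrite !big_seq1; case: P.
rewrite !big_words !big_cons !big_nil !addr0 /=.
case: P => [|p P] /=.
  by rewrite !big1 ?addr0 // => *; rewrite mul0r.
have IHr x p' : \sum_(r <- words dirs m) (covers p' P r)%:R
        * H (w ++ x :: row_vectors z k.+1 r) =
    \sum_(s <- words [:: true; false] m) (interlaces p' P s)%:R *
     H (w ++ x :: [seq z x + z x.-1 | x <- positions k.+1 s]).
  under eq_bigr do rewrite -cat_rcons; rewrite IH.
  by under eq_bigr do rewrite cat_rcons.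
have s0 (T : Type) (A : seq T) (F : T -> R) : \sum_(r <- A) 0 * F r = 0.
  by rewrite big1 // => *; rewrite mul0r.
case: pend p => [] [] /=; rewrite ?s0 ?addr0 ?add0r //.
all: rewrite ?IHr ?IH ?addr0 // addrA; congr (_ + _).
all: by rewrite -big_split /=; apply: eq_bigr => s _; rewrite mH mulrDr.
Qed.

Definition partial_sum e (p : nat) : V := \sum_(x < p) e x.

(** An admissible pattern has one particle in each half-open gap between consecutive positions of
    [P] and none after the last, whence one difference of partial sums per gap. With [pend] a gap
    starting at [k] is already open. With neither a position nor [pend], the outermost white square
    cannot be hit. *)
Lemma sum_interlaces H e m pend P k w : multiadditive H -> size P = m.+1 ->
  \sum_(s <- words [:: true; false] m) (interlaces pend P s)%:R *
     H (w ++ [seq e x | x <- positions k s]) =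
  if (if pend then k :: positions k P else positions k P) is p :: l
  then H (w ++ pairmap (fun p q => partial_sum e q - partial_sum e p) p l) else 0.
Proof.
move=> mH; elim: m pend P k w => [|m IH] pend [|p P] k w // [sP].
  rewrite [words _ _]/= big_seq1; case: P sP => //= _; case: pend p => [] [] /=;
    rewrite ?mul1r ?mul0r ?cats0 // subrr.
  by rewrite multiadditive0.
rewrite !big_words !big_cons !big_nil !addr0 /=.
have s0 (T : Type) (A : seq T) (F : T -> R) : \sum_(r <- A) 0 * F r = 0.
  by rewrite big1 // => *; rewrite mul0r.
have IHr x p' : \sum_(s <- words [:: true; false] m) (interlaces p' P s)%:R *
     H (w ++ x :: [seq e x | x <- positions k.+1 s]) =
  if (if p' then k.+1 :: positions k.+1 P else positions k.+1 P) is p :: l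
  then H (w ++ x :: pairmap (fun p q => partial_sum e q - partial_sum e p) p l) else 0.
  under eq_bigr do rewrite -cat_rcons; rewrite IH //.
  by case: p' => /=; [|case: (positions _ _) => // ? ?]; rewrite cat_rcons.
have sumS : partial_sum e k.+1 = partial_sum e k + e k.
  by rewrite /partial_sum big_ord_recr.
case: pend p => [] [] /=; rewrite ?s0 ?addr0 ?add0r // ?IHr ?IH //=.
(* Here the open gap is empty, and both sides vanish. *)
- by rewrite subrr multiadditive0.
all: case: (positions _ _) => [|q l] /=; rewrite ?add0r //.
all: by rewrite -mH; congr (H (w ++ _ :: _)); rewrite sumS opprD addrCA [X in _ + X]addrC subrK.
Qed.

(** The differences are formed from the last entry backwards, so that each predecessor is still
    unchanged when it is subtracted; the correction term repeats it. *)
Lemma alternating_pairmap H z w p l : multiadditive H -> alternating H ->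
  H (w ++ z p :: map z l) = H (w ++ z p :: pairmap (fun p q => z q - z p) p l).
Proof.
move=> mH aH; elim: l p w => //= q l IH p w.
rewrite -cat_rcons IH cat_rcons -[in LHS](subrK (z p) (z q)) -cat_rcons mH.
by rewrite !cat_rcons aH addr0.
Qed.

Lemma no_collision_occupied H z w k own r : alternating H ->
  (no_collision own r)%:R * H (w ++ map z (positions k (occupied own r))) =
  H (w ++ (if own then [:: z k] else [::]) ++ row_vectors z k.+1 r).
Proof.
move=> aH; elim: r own k w => [|d r IH] own k w.
  by rewrite /= mul1r; case: own.
have IHr x own' : (no_collision own' r)%:R *
    H (w ++ x :: map z (positions k.+1 (occupied own' r))) =
  H (w ++ x :: (if own' then [:: z k.+1] else [::]) ++ row_vectors z k.+2 r).
  by rewrite -cat_rcons IH cat_rcons.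
by case: d own => [] [] [] [] /=; rewrite ?IHr ?IH ?mul0r ?aH.
Qed.

End Rows.

Lemma contract_zero (R : comNzRingType) (T : Type) (c : T -> R) G w :
  all (fun x => c x == 0) w -> contract c G w = 0.
Proof.
elim: w G => //= x w IH G /andP[/eqP-> /IH ->].
by rewrite mul0r subr0.
Qed.

(* The innermost white square is matched with its mirror image unless the innermost black
   square is; hence the carry [~~ d.1] below, as if the former had been hit from its row. *)
Definition row_ok (r : seq dir) : bool :=
  if r is d :: r' then (d != (true, true)) && no_collision (~~ d.1) r' else false.

Definition row_occupied (r : seq dir) : seq bool :=
  if r is d :: r' then occupied (~~ d.1) r' else [::].

Lemma size_row_occupied n r : size r = n.+1 -> size (row_occupied r) = n.+1.
Proof.
by case: r => //= d r [<-]; elim: r (~~ _) => //= {}d r IH b; rewrite IH.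
Qed.

(** [P] tells which white squares of the current row are hit from their own row; the rows of [X] lie
    above. *)
Fixpoint completes (P : seq bool) (X : seq (seq dir)) : bool :=
  if X is r :: X' then
    [&& covers false P r, row_ok r & completes (row_occupied r) X']
  else covers false P [::].

(** Row [i] of the left half, counted from 0, has [n - i] black squares. *)
Fixpoint triangles (n : nat) : seq (seq (seq dir)) :=
  if n is n'.+1 then [seq r :: X | r <- words dirs n, X <- triangles n']
  else [:: [::]].

Lemma big_triangles (R : comNzRingType) n (F : seq (seq dir) -> R) :
  \sum_(X <- triangles n.+1) F X =
  \sum_(r <- words dirs n.+1) \sum_(X <- triangles n) F (r :: X).
Proof. exact: big_allpairs_dep. Qed.

(* Removed boundary squares are given the direction down. *)
Fixpoint starts (s : seq bool) (r : seq dir) : bool :=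
  match s, r with
  | b :: s', d :: r' => [&& d.1 == b, d.1 || d.2 & starts s' r']
  | [::], [::] => true
  | _, _ => false
  end.

Definition completes_from (s : seq bool) (X : seq (seq dir)) : bool :=
  if X is r :: X' then
    [&& starts s r, row_ok r & completes (row_occupied r) X']
  else false.

(** * Transfer of the weight from row to row *)

Section Count.
Variables (R : comNzRingType) (V : zmodType) (B : V -> V -> R) (e : nat -> V).
Hypotheses (Br : forall u, additive_fun (B u)) (Bl : forall v, additive_fun (B^~ v)).
Hypothesis B0 : forall x, B x x = 0.
Let E := partial_sum e.
Hypothesis B_e0 : forall t, B (e 0) (e t.+1) = 2.
Hypothesis B_eS : forall s t,
  B (e s.+1) (e t.+1) = B (E s.+1 + E s) (E t.+1 + E t).

(* Summing over the interlacing patterns contracts with the functional 1, which is not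
   linear in the partial sums; it is carried along as a second component. *)
Definition weight (w : seq (V * R)) : R :=
  contract snd (fun u => pfaffian B (map fst u)) w.
Definition lifted_sum (p : nat) : V * R := (E p, 1).

Lemma weight_multiadditive : multiadditive weight.
Proof.
apply: contract_multiadditive => // s1 s2 u v.
by rewrite !map_cat /= (pfaffian_multiadditive Br Bl).
Qed.

Lemma weight_alternating : alternating weight.
Proof.
apply: contract_alternating => s1 s2 v.
by rewrite !map_cat /= (pfaffian_alternating B0).
Qed.

(** After passage to differences, [snd] is 1 on the first entry and 0 on the others, so the
    contraction merely deletes the first. What remains is the outcome of [sum_interlaces]. *)
Lemma weight_pairmap p l :
  weight (map lifted_sum (p :: l)) =
  pfaffian B (pairmap (fun p q => E q - E p) p l).
Proof.
have := alternating_pairmap lifted_sum [::] p l weight_multiadditive weight_alternating.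
rewrite /= => ->; rewrite /weight /= mul1r contract_zero ?subr0.
  by congr (pfaffian _ _); elim: l p => //= q l IH p; rewrite IH.
by elim: l p => //= q l IH p; rewrite IH andbT subrr.
Qed.

Let doubled x := lifted_sum x + lifted_sum x.-1.

Lemma pfaffian_doubled t :
  pfaffian B (map fst (map doubled (map S t))) = pfaffian B (map e (map S t)).
Proof.
rewrite -!map_comp !pfaffian_map /=.
by apply: eq_pfaffian => x y; rewrite B_eS.
Qed.

(** A particle is created at the centre. Since [E 0 = 0], only the term deleting this entry survives
    the contraction. *)
Lemma weight_row_center t :
  weight (lifted_sum 0 :: map doubled (map S t)) = pfaffian B (map e (map S t)).
Proof.
rewrite /weight /= mul1r pfaffian_doubled (@eq_contract _ _ snd snd _ (fun=> 0)) //.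
  by rewrite contract0 subr0.
move=> u _; rewrite /= /E /partial_sum big_ord0.
exact: (multiadditive0 [::] _ (pfaffian_multiadditive Br Bl)).
Qed.

(** A particle is absorbed by the centre. A [doubled] vector has second component 1 + 1, so
    contracting with [snd] is the expansion along the row of [e 0], whose other entries are 2. *)
Lemma weight_row0 t :
  weight (map doubled (map S t)) = pfaffian B (map e (0%N :: map S t)).
Proof.
rewrite /weight /= pfaffian_cons !contract_map; apply: eq_contract => [x|u _].
  by rewrite B_e0.
exact: pfaffian_doubled.
Qed.

Lemma positions_succ k s : positions k.+1 s = map S (positions k s).
Proof. by elim: s k => //= -[] s IH k; rewrite IH. Qed.

Lemma row_ok_weight d r :
  (row_ok (d :: r))%:R * weight (map lifted_sum (positions 0 (row_occupied (d :: r)))) =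
  (d != (true, true))%:R *
    weight ((if d.1 then [::] else [:: lifted_sum 0]) ++ row_vectors lifted_sum 1 r).
Proof.
rewrite /= -mulnb natrM -mulrA.
rewrite (no_collision_occupied _ [::] _ _ _ weight_alternating) cat0s.
by case: d.1.
Qed.

(** [weight] is invariant under the transfer from one row to the next: first the choices of staying
    or jumping are summed out, then the interlacing patterns. *)
Lemma sum_covers_weight m P : size P = m.+2 ->
  \sum_(r <- words dirs m.+1) (covers false P r && row_ok r)%:R *
    weight (map lifted_sum (positions 0 (row_occupied r))) =
  weight (map lifted_sum (positions 0 P)).
Proof.
case: P => // p P [sP].
transitivity (\sum_(s <- words [:: true; false] m.+1)
   (interlaces false (p :: P) s)%:R * pfaffian B ([::] ++ [seq e x | x <- positions 0 s])).
  under eq_bigr do rewrite -mulnb natrM -mulrA.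
  rewrite !big_words !big_cons !big_nil !addr0.
  (* For the innermost black square, up is forbidden, right absorbs a particle, and down and left
     create one at the centre. *)
  under eq_bigr do rewrite row_ok_weight mul0r mulr0.
  under [X in _ + (X + _)]eq_bigr do rewrite row_ok_weight mul1r.
  under [X in _ + (_ + (X + _))]eq_bigr do rewrite row_ok_weight mul1r.
  under [X in _ + (_ + (_ + X))]eq_bigr do rewrite row_ok_weight mul1r.
  rewrite big1 ?add0r //.
  have s0 (T : Type) (A : seq T) (F : T -> R) : \sum_(r <- A) 0 * F r = 0.
    by rewrite big1 // => *; rewrite mul0r.
  have row q w : \sum_(r <- words dirs m) (covers q P r)%:R *
       weight (w ++ row_vectors lifted_sum 1 r) =
     \sum_(s <- words [:: true; false] m) (interlaces q P s)%:R *
       weight (w ++ map doubled (map S (positions 0 s))).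
    rewrite (sum_covers _ _ _ _ _ _ weight_multiadditive).
    by under eq_bigr do rewrite positions_succ.
  (* If the innermost white square below is hit already, the innermost black square goes right or
     left; otherwise it goes down. *)
  case: p => /=; rewrite ?s0 ?addr0 ?add0r ?(row _ [::]) ?(row _ [:: _]).
    congr (_ + _); apply: eq_bigr => s _; rewrite positions_succ.
      by rewrite -weight_row0.
    by rewrite -weight_row_center.
  by apply: eq_bigr => s _; rewrite positions_succ -weight_row_center.
rewrite (sum_interlaces _ _ _ _ (pfaffian_multiadditive Br Bl)) /=; last by rewrite sP.
case: (if p then _ else _) => [|q l]; first by [].
by rewrite weight_pairmap.
Qed.

Lemma sum_completes n P : size P = n.+1 ->
  \sum_(X <- triangles n) (completes P X)%:R = weight (map lifted_sum (positions 0 P)).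
Proof.
elim: n P => [|n IH] P sP.
  case: P sP => [|p []] //= _; rewrite big_seq1; case: p => //=.
  by rewrite /weight /= mul1r subr0.
rewrite -(sum_covers_weight sP) big_triangles.
apply: eq_big_seq => r; rewrite mem_words => /andP[/eqP sr _].
rewrite -(IH _ (size_row_occupied sr)).
by rewrite mulr_sumr; apply: eq_bigr => X _ /=; rewrite -natrM mulnb andbA.
Qed.

Lemma sum_starts z (H : seq (V * R) -> R) s w k : multiadditive H ->
  \sum_(r <- words dirs (size s)) (starts s r)%:R * H (w ++ row_vectors z k r) =
  H (w ++ [seq z x + z x.-1 | x <- positions k s]).
Proof.
move=> mH; elim: s k w => [|b s IH] k w; first by rewrite big_seq1 mul1r.
have IHr x : \sum_(r <- words dirs (size s)) (starts s r)%:R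
        * H (w ++ x :: row_vectors z k.+1 r) =
     H (w ++ x :: [seq z x + z x.-1 | x <- positions k.+1 s]).
  by under eq_bigr do rewrite -cat_rcons; rewrite IH cat_rcons.
rewrite big_words !big_cons big_nil /=.
have s0 (T : Type) (A : seq T) (F : T -> R) : \sum_(r <- A) 0 * F r = 0.
  by rewrite big1 // => *; rewrite mul0r.
case: b => /=; rewrite ?s0 ?addr0 ?add0r.
  by rewrite !IHr mH.
by rewrite IH.
Qed.

Lemma sum_completes_from s : (0 < size s)%N ->
  \sum_(X <- triangles (size s)) (completes_from s X)%:R =
  pfaffian B (map e (positions 0 s)).
Proof.
case: s => // b s _; rewrite big_triangles.
transitivity (\sum_(r <- words dirs (size s).+1)
   ((starts (b :: s) r) && row_ok r)%:R *
     weight (map lifted_sum (positions 0 (row_occupied r)))).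
  apply: eq_big_seq => r; rewrite mem_words => /andP[/eqP sr _].
  rewrite -(sum_completes (size_row_occupied sr)).
  by rewrite mulr_sumr; apply: eq_bigr => X _ /=; rewrite -natrM mulnb andbA.
under eq_bigr do rewrite -mulnb natrM -mulrA.
rewrite big_words !big_cons big_nil addr0.
under eq_bigr do rewrite row_ok_weight mul0r mulr0.
under [X in _ + (X + _)]eq_bigr do rewrite row_ok_weight mul1r.
under [X in _ + (_ + (X + _))]eq_bigr do rewrite row_ok_weight mul1r.
under [X in _ + (_ + (_ + X))]eq_bigr do rewrite row_ok_weight mul1r.
rewrite big1 ?add0r //.
have s0 (T : Type) (A : seq T) (F : T -> R) : \sum_(r <- A) 0 * F r = 0.
  by rewrite big1 // => *; rewrite mul0r.
have row w : \sum_(r <- words dirs (size s)) (starts s r)%:R *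
     weight (w ++ row_vectors lifted_sum 1 r) =
   weight (w ++ map doubled (map S (positions 0 s))).
  by rewrite (sum_starts _ _ _ _ weight_multiadditive) positions_succ.
case: b => /=; rewrite ?s0 ?addr0 ?add0r ?(row [::]) ?(row [:: _]) positions_succ.
  by rewrite -weight_row0.
by rewrite -weight_row_center.
Qed.

End Count.

(** * The coupling form *)

Section PolynomialForm.
Variable R : comNzRingType.
Implicit Types (f : nat -> R) (p q : {poly R}) (a : nat -> nat -> R).

(** Polynomials serve as the free module with basis ['X^i]: this is the linear functional with
    values [f i] on it, and [poly_form a] is the bilinear form with Gram matrix [a]. *)
Definition poly_pairing f p := \sum_(i < size p) p`_i * f i.

Lemma poly_pairing_widen N f p : (size p <= N)%N ->
  poly_pairing f p = \sum_(i < N) p`_i * f i.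
Proof.
move=> pN; rewrite /poly_pairing (big_ord_widen N (fun i => p`_i * f i) pN).
rewrite [RHS](bigID (fun i : 'I_N => (i < size p)%N)) /= [X in _ + X]big1 ?addr0 //.
by move=> i; rewrite -leqNgt => /(nth_default 0) ->; rewrite mul0r.
Qed.

Lemma poly_pairing_additive f : additive_fun (poly_pairing f).
Proof.
move=> p q; set N := maxn (size p) (size q).
rewrite (@poly_pairing_widen N) ?size_polyD // !(@poly_pairing_widen N) ?leq_maxl ?leq_maxr //.
by rewrite -big_split; apply: eq_bigr => i _; rewrite coefD mulrDl.
Qed.

Lemma poly_pairing_Xn f i : poly_pairing f 'X^i = f i.
Proof.
rewrite /poly_pairing size_polyXn big_ord_recr /= coefXn eqxx mul1r big1 ?add0r //.
by move=> j _; rewrite coefXn ltn_eqF ?mul0r.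
Qed.

Definition poly_form a p q := poly_pairing (fun i => poly_pairing (a i) q) p.

Lemma poly_form_additivel a q : additive_fun ((poly_form a)^~ q).
Proof. exact: poly_pairing_additive. Qed.

Lemma poly_form_additiver a p : additive_fun (poly_form a p).
Proof.
move=> q q'; rewrite /poly_form /poly_pairing -big_split; apply: eq_bigr => i _ /=.
by rewrite -mulrDr; congr (_ * _); apply: poly_pairing_additive.
Qed.

Lemma poly_form_antisym a p q : (forall i j, a i j = - a j i) ->
  poly_form a p q = - poly_form a q p.
Proof.
move=> aN; rewrite /poly_form /poly_pairing.
under eq_bigr do rewrite mulr_sumr.
rewrite exchange_big -sumrN; apply: eq_bigr => i _ /=.
rewrite mulr_sumr -sumrN; apply: eq_bigr => j _.
by rewrite aN; ring.
Qed.

Lemma poly_form_Xn a i j : poly_form a 'X^i 'X^j = a i j.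
Proof. by rewrite /poly_form !poly_pairing_Xn. Qed.

Lemma additive_fun_sum (V W : zmodType) (c : V -> W) n (F : 'I_n -> V) :
  additive_fun c -> c (\sum_(i < n) F i) = \sum_(i < n) c (F i).
Proof. by move=> ac; apply: big_morph => //; apply: additive_fun0. Qed.

End PolynomialForm.

Definition double_sum (a : nat -> nat -> int) (p q : nat) : int :=
  \sum_(x < p) \sum_(y < q) a x y.

(* [N] is fuel: the value depends on it only through [s < N].  The last clause says
   that one round of moves preserves the form, see [couplingS]. *)
Fixpoint coupling_rec (N s t : nat) : int :=
  if N is N'.+1 then
    match s, t with
    | 0, 0 => 0
    | 0, _.+1 => 2
    | _.+1, 0 => - 2
    | s'.+1, t'.+1 =>
        let g := double_sum (coupling_rec N') in
        g s t + g s t' + (g s' t + g s' t')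
    end
  else 0.

Definition coupling s t := coupling_rec s.+1 s t.

Lemma coupling_recE N s t : (s < N)%N -> coupling_rec N s t = coupling s t.
Proof.
suff rE M : (s < M)%N -> (s < N)%N -> coupling_rec N s t = coupling_rec M s t.
  exact: rE.
elim: N M s t => [|N IH] [|M] [|s] [|t] //= sM sN.
have eg p q : (p <= s.+1)%N ->
    double_sum (coupling_rec N) p q = double_sum (coupling_rec M) p q.
  move=> ps; apply: eq_bigr => x _; apply: eq_bigr => y _.
  by apply: IH; apply: leq_trans (ltn_ord x) (leq_trans ps _).
by rewrite !eg.
Qed.

Lemma coupling_rec_antisym N s t : coupling_rec N s t = - coupling_rec N t s.
Proof.
elim: N s t => [|N IH] [|s] [|t] //=; rewrite ?oppr0 ?opprK //.
have gN p q : double_sum (coupling_rec N) p q = - double_sum (coupling_rec N) q p.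
  rewrite /double_sum exchange_big -sumrN; apply: eq_bigr => x _.
  by rewrite -sumrN; apply: eq_bigr => y _.
by rewrite (gN s.+1 t.+1) (gN s.+1 t) (gN s t.+1) (gN s t); ring.
Qed.

Lemma coupling_antisym s t : coupling s t = - coupling t s.
Proof.
(* The two values are defined with different fuels and are brought to a common one. *)
rewrite -(@coupling_recE (s + t).+1 s t) ?ltnS ?leq_addr //.
rewrite -(@coupling_recE (s + t).+1 t s) ?ltnS ?leq_addl //.
exact: coupling_rec_antisym.
Qed.

Lemma couplingS s t : coupling s.+1 t.+1 =
  double_sum coupling s.+1 t.+1 + double_sum coupling s.+1 t
    + (double_sum coupling s t.+1 + double_sum coupling s t).
Proof.
have eg p q : (p <= s.+1)%N ->
    double_sum (coupling_rec s.+1) p q = double_sum coupling p q.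
  move=> ps; apply: eq_bigr => x _; apply: eq_bigr => y _.
  by apply: coupling_recE; apply: leq_trans (ltn_ord x) ps.
by rewrite -!eg.
Qed.

(** The bilinear extension of [coupling] to polynomials meets the hypotheses of
    [sum_completes_from]; the last of them is [couplingS], read on partial sums. *)
Lemma count_completes_from s : (0 < size s)%N ->
  (count (completes_from s) (triangles (size s)))%:Z =
  pfaffian coupling (positions 0 s).
Proof.
move=> s0; pose e i : {poly int} := 'X^i.
have eB p q : poly_form coupling (partial_sum e p) (partial_sum e q) =
    double_sum coupling p q.
  rewrite /partial_sum /double_sum.
  rewrite (additive_fun_sum _ (poly_form_additivel _ _)); apply: eq_bigr => x _.
  rewrite (additive_fun_sum _ (poly_form_additiver _ _)); apply: eq_bigr => y _.
  exact: poly_form_Xn.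
have := @sum_completes_from _ _ (poly_form coupling) e (poly_form_additiver _)
  (poly_form_additivel _) _ _ _ s s0.
rewrite pfaffian_map (eq_pfaffian _ (B' := coupling)); last first.
  by move=> x y; rewrite poly_form_Xn.
move=> <-.
- rewrite -natr_sum natz -sum1_count big_mkcond.
  by congr Posz; apply: eq_bigr => X _; case: (completes_from _ _).
(* An integer equal to its opposite is 0. *)
- move=> x; have := poly_form_antisym x x coupling_antisym; lia.
- by move=> t; rewrite poly_form_Xn.
- move=> i j; rewrite poly_form_Xn couplingS poly_form_additivel !poly_form_additiver.
  by rewrite !eB.
Qed.

(** * Expansion of the Pfaffian along the first row *)

Lemma lift_perm_exists n (i j : 'I_n.+1) (s : 'S_n.+1) :
  s i = j -> exists s' : 'S_n, s = lift_perm i j s'.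
Proof.
move=> sij; pose f k := odflt k (unlift j (s (lift i k))).
have fK k : lift j (f k) = s (lift i k).
  rewrite /f; case: unliftP => [k' ->|eqj] //.
  by have := neq_lift i k; rewrite -(inj_eq (@perm_inj _ s)) sij eqj eqxx.
have f_inj : injective f.
  by move=> k k' eqf; apply: (@lift_inj _ i); apply: (@perm_inj _ s); rewrite -!fK eqf.
exists (perm f_inj); apply/permP => k.
case: (unliftP i k) => [k'|] ->; first by rewrite lift_perm_lift permE fK.
by rewrite lift_perm_id.
Qed.

Lemma is_pf_matchingP r (s : 'S_r) :
  reflect ((forall i j : 'I_r, ~~ odd i -> j = i.+1 :> nat -> (s i < s j)%N) /\
           (forall i j : 'I_r, ~~ odd i -> ~~ odd j -> (i < j)%N -> (s i < s j)%N))
          (is_pf_matching s).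
Proof.
apply: (iffP andP) => -[m1 m2]; split.
- move=> i j oi ij; move/forallP/(_ i)/forallP/(_ j)/implyP: m1; apply.
  by rewrite oi ij eqxx.
- move=> i j oi oj ij; move/forallP/(_ i)/forallP/(_ j)/implyP: m2; apply.
  by rewrite oi oj ij.
- apply/forallP => i; apply/forallP => j; apply/implyP => /andP[oi /eqP]; exact: m1.
- apply/forallP => i; apply/forallP => j; apply/implyP => /and3P[oi oj]; exact: m2.
Qed.

(** The matching that joins 0 to [k + 1] and follows [s] on the other points, relabelled
    increasingly. *)
Definition extend_matching r (k : 'I_r.+1) (s : 'S_r) : 'S_r.+2 :=
  lift_perm ord0 ord0 (lift_perm ord0 k s).

Lemma extend_matching_inj r :
  injective (fun ks : 'I_r.+1 * 'S_r => extend_matching ks.1 ks.2).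
Proof.
move=> [k s] [k' s'] /= /permP eqs.
have ek : k = k'.
  have := eqs (lift ord0 ord0); rewrite !lift_perm_lift !lift_perm_id.
  exact: lift_inj.
rewrite ek in eqs *; congr (_, _); apply/permP => i.
by have := eqs (lift ord0 (lift ord0 i)); rewrite !lift_perm_lift => /lift_inj/lift_inj.
Qed.

(** The relabelling is increasing, so the conditions on the later pairs are those of [s]; those
    involving the first pair hold because 0 is the least value. *)
Lemma is_pf_matching_extend r (k : 'I_r.+1) (s : 'S_r) :
  is_pf_matching (extend_matching k s) = is_pf_matching s.
Proof.
have lt_lift2 (i j : 'I_r) :
    (lift ord0 (lift k i) < lift ord0 (lift k j))%N = (i < j)%N.
  by rewrite /= /bump !add1n ltnS; lia.
have e2 i : extend_matching k s (lift ord0 (lift ord0 i)) = lift ord0 (lift k (s i)).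
  by rewrite /extend_matching !lift_perm_lift.
have e0 : extend_matching k s ord0 = ord0 by rewrite /extend_matching lift_perm_id.
have e1 : extend_matching k s (lift ord0 ord0) = lift ord0 k.
  by rewrite /extend_matching lift_perm_lift lift_perm_id.
apply/is_pf_matchingP/is_pf_matchingP => -[m1 m2]; split=> i j.
- move=> oi ij; rewrite -lt_lift2 -!e2; apply: m1 => /=; rewrite /bump; lia.
- move=> oi oj ij; rewrite -lt_lift2 -!e2; apply: m2 => /=; rewrite /bump; lia.
- case: (unliftP ord0 i) => [i'|] ->; last first.
    rewrite e0; case: (unliftP ord0 j) => [j'|] -> //= _.
    case: (unliftP ord0 j') => [j''|] -> //=; last by rewrite e1.
  case: (unliftP ord0 i') => [i''|] -> //=.
  case: (unliftP ord0 j) => [j'|] -> //=.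
  case: (unliftP ord0 j') => [j''|] -> //=; rewrite /bump !add1n !negbK => oi ij.
  by rewrite !e2 lt_lift2; apply: m1 => //; lia.
- case: (unliftP ord0 j) => [j'|] -> //=.
  case: (unliftP ord0 j') => [j''|] -> //=.
  case: (unliftP ord0 i) => [i'|] -> //=; last by rewrite e0 e2.
  case: (unliftP ord0 i') => [i''|] -> //=; rewrite /bump !add1n !negbK => oi oj ij.
  by rewrite !e2 lt_lift2; apply: m2.
Qed.

(** The value 0 comes first: at any other position the value exceeds that of the partner or that of
    position 0. *)
Lemma is_pf_matching_exists r (s : 'S_r.+2) : is_pf_matching s ->
  exists k s', s = extend_matching k s'.
Proof.
move=> /is_pf_matchingP[m1 m2].
have s0 : s ord0 = ord0.
  have [i si] : exists i, s i = ord0 by exists ((s^-1)%g ord0); rewrite permKV.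
  case: (posnP i) => [i0|i_gt0]; first by rewrite -[in RHS]si; congr (s _); apply: val_inj.
  have [oi|oi] := boolP (odd i).
    have ltj : (i.-1 < r.+2)%N by rewrite (leq_ltn_trans (leq_pred _)).
    have: (s (Ordinal ltj) < s i)%N by apply: m1; rewrite /= ?prednK // -oddS prednK.
    by rewrite si.
  by have := m2 ord0 i isT oi i_gt0; rewrite si.
have [t ->] := lift_perm_exists s0.
by have [s' ->] := lift_perm_exists (erefl (t ord0)); exists (t ord0), s'.
Qed.

Lemma prod_matched_pairs (R : comNzRingType) r (F : nat -> nat -> R) :
  \prod_(p : 'I_r.+2 * 'I_r.+2 | ~~ odd p.1 && (p.2 == p.1.+1 :> nat)) F p.1 p.2 =
  F 0 1 * \prod_(p : 'I_r * 'I_r | ~~ odd p.1 && (p.2 == p.1.+1 :> nat)) F p.1.+2 p.2.+2.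
Proof.
have prodE n (G : nat -> nat -> R) :
    \prod_(p : 'I_n * 'I_n | ~~ odd p.1 && (p.2 == p.1.+1 :> nat)) G p.1 p.2 =
    \prod_(i < n) \prod_(j < n) if ~~ odd i && (j == i.+1 :> nat) then G i j else 1.
  by rewrite big_mkcond pair_big.
rewrite prodE (prodE r (fun i j => F i.+2 j.+2)).
rewrite big_ord_recl [X in _ * X]big_ord_recl /=.
rewrite [X in _ * (X * _)]big1 // mul1r; congr (_ * _).
  by rewrite 2!big_ord_recl /= mul1r big1 ?mulr1.
apply: eq_bigr => i _; rewrite 2!big_ord_recl /= /bump /=.
rewrite !add1n !eqSS !andbF !mul1r.
by apply: eq_bigr => j _; rewrite !add1n !eqSS !negbK.
Qed.

(** Grouping the matchings by the partner of 0 gives the terms of [contractE]. *)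
Lemma pf_pfaffian (R : comNzRingType) (T : Type) (x0 : T) (A : T -> T -> R) r (w : seq T) :
  size w = r ->
  pf (\matrix_(k < r, l < r) A (nth x0 w k) (nth x0 w l)) = pfaffian A w.
Proof.
elim/ltn_ind: r w => -[|[|r]] IH w sw.
- case: w sw => // _; rewrite /pf /= (big_pred1 1%g) => [|s]; last first.
    have -> : is_pf_matching s by apply/is_pf_matchingP; split=> i; have := ltn_ord i.
    by symmetry; apply/eqP/permP => i; have := ltn_ord i.
  by rewrite odd_perm1 mul1r big1 // => -[i]; have := ltn_ord i.
- by case: w sw => [|x []].
case: w sw => // x w [sw].
rewrite pfaffian_cons (contractE _ _ x0) sw /pf /= negbK.
case: ifP => [or|odr].
  (* For odd [r] each term contains a smaller Pfaffian of odd order. *)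
  rewrite big1 // => k _; rewrite -(IH r) ?/pf ?or ?mulr0 //.
  by rewrite size_cat size_takel ?size_drop ?sw; have := ltn_ord k; lia.
rewrite (eq_bigl (mem [set s : 'S_r.+2 | is_pf_matching s])); last first.
  by move=> s; rewrite /= inE.
have -> : [set s : 'S_r.+2 | is_pf_matching s] =
    [set extend_matching ks.1 ks.2 | ks in [set ks : 'I_r.+1 * 'S_r | is_pf_matching ks.2]].
  apply/setP => s; rewrite inE; apply/idP/imsetP => [ms|[ks]].
    have [k [s' es]] := is_pf_matching_exists ms.
    by exists (k, s'); rewrite // inE -(is_pf_matching_extend k) -es.
  by rewrite inE => ms ->; rewrite is_pf_matching_extend.
rewrite big_imset /=; last by move=> ? ? _ _; apply: extend_matching_inj.
rewrite (eq_bigl (fun ks : 'I_r.+1 * 'S_r => true && is_pf_matching ks.2)); last first.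
  by move=> ks; rewrite inE.
rewrite -(pair_big xpredT (fun s => is_pf_matching s) (fun k s =>
  (-1) ^+ extend_matching k s * \prod_(p : 'I_r.+2 * 'I_r.+2 | ~~ odd p.1 && (p.2 == p.1.+1 :> nat))
   (\matrix_(k, l) A (nth x0 (x :: w) k) (nth x0 (x :: w) l)) (extend_matching k s p.1) (extend_matching k s p.2))) /=.
apply: eq_bigr => k _.
set w' := take k w ++ _.
have sw' : size w' = r.
  by rewrite size_cat size_takel ?size_drop ?sw; have := ltn_ord k; lia.
rewrite -(IH r) // /pf odr mulr_sumr; apply: eq_bigr => s _.
have nthw i : nth x0 w' i = nth x0 w (bump k i).
  by rewrite /w' nth_cat size_takel ?sw ?(ltnW (ltn_ord k)) // /bump;
     case: ltnP => ki; rewrite ?nth_take // nth_drop; congr nth; lia.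
pose sx (i : nat) : T := nth x0 (x :: w) (extend_matching k s (inord i)).
transitivity ((-1) ^+ (k + s) * (A (sx 0%N) (sx 1%N) *
  \prod_(p : 'I_r * 'I_r | ~~ odd p.1 && (p.2 == p.1.+1 :> nat)) A (sx p.1.+2) (sx p.2.+2))).
  rewrite -(prod_matched_pairs _ (fun i j => A (sx i) (sx j))); congr (_ * _).
    (* [lift_perm i j] contributes the sign of [i + j], which makes [(-1) ^+ k] in all. *)
    by rewrite /extend_matching !odd_lift_perm /= signr_addb signr_odd exprD.
  by apply: eq_bigr => p _; rewrite mxE /sx !inord_val.
have -> : sx 0%N = x.
  rewrite /sx (_ : inord 0 = ord0) ?lift_perm_id //.
  by apply: val_inj; rewrite /= inordK.
have -> : sx 1%N = nth x0 w k.
  rewrite /sx (_ : inord 1 = lift ord0 ord0) ?lift_perm_lift ?lift_perm_id //.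
  by apply: val_inj; rewrite /= inordK.
have sxE (i : 'I_r) : sx i.+2 = nth x0 w' (s i).
  rewrite /sx (_ : inord i.+2 = lift ord0 (lift ord0 i)) ?lift_perm_lift ?nthw //.
  by apply: val_inj; rewrite /= inordK // !ltnS.
have -> : \prod_(p : 'I_r * 'I_r | ~~ odd p.1 && (p.2 == p.1.+1 :> nat))
      A (sx p.1.+2) (sx p.2.+2) =
    \prod_(p : 'I_r * 'I_r | ~~ odd p.1 && (p.2 == p.1.+1 :> nat))
      (\matrix_(k, l) A (nth x0 w' k) (nth x0 w' l)) (s p.1) (s p.2).
  by apply: eq_bigr => p _; rewrite mxE !sxE.
by rewrite exprD -!mulrA [(-1) ^+ s * _]mulrCA.
Qed.

(** * Tilings as direction fields *)

Definition step (d : dir) (q : square) : square :=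
  match d with
  | (true, true) => (q.1, q.2 + 1)
  | (true, false) => (q.1 + 1, q.2)
  | (false, true) => (q.1, q.2 - 1)
  | (false, false) => (q.1 - 1, q.2)
  end.

(** The second component tells vertical from horizontal: reversal always flips the first one, the
    reflection only for horizontal directions. *)
Definition opp_dir (d : dir) : dir := (~~ d.1, d.2).
Definition mirror_dir (d : dir) : dir := (if d.2 then d.1 else ~~ d.1, d.2).

Lemma mirrorK : involutive mirror.
Proof. by case=> a b; congr (_, _); rewrite /=; lia. Qed.

Lemma mirror_dirK : involutive mirror_dir. Proof. by case=> [] [] []. Qed.

Lemma opp_mirror_dir d : opp_dir (mirror_dir d) = mirror_dir (opp_dir d).
Proof. by case: d => [] [] []. Qed.

Lemma step_opp d q : step (opp_dir d) (step d q) = q.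
Proof. by case: q => a b; case: d => [] [] []; congr (_, _); rewrite /=; lia. Qed.

Lemma step_mirror d q : step (mirror_dir d) (mirror q) = mirror (step d q).
Proof. by case: q => a b; case: d => [] [] []; congr (_, _); rewrite /=; lia. Qed.

Lemma step_neq d q : step d q != q.
Proof. by case: q => a b; case: d => [] [] []; apply/eqP => -[]; lia. Qed.

Lemma step_inj q : injective (step^~ q).
Proof.
by case: q => a b [[] []] [[] []] //= []; lia.
Qed.

Lemma adjacentP p q : reflect (exists d, q = step d p) (adjacent p q).
Proof.
apply: (iffP eqP) => [|[d ->]].
  case: p q => [a b] [a' b'] /= h.
  have [[-> ->]|[[-> ->]|[[-> ->]|[-> ->]]]] : a' = a /\ b' = b + 1 \/ a' = a + 1 /\ b' = b \/
     a' = a /\ b' = b - 1 \/ a' = a - 1 /\ b' = b by lia.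
  - by exists (true, true).
  - by exists (true, false).
  - by exists (false, true).
  - by exists (false, false).
by case: p => a b; case: d => [] [] [] /=; lia.
Qed.

(* Position [k] of row [i], both counted from 0; the squares of the left half are those
   with [i + k < n].  The [k+1]-st square of the southwestern boundary is
   [black n 0 k], and the [i+1]-st diagonal cell contains [black n i 0], [white n i 0]. *)
Definition black (n i k : nat) : square := (- k.+1%:Z, k%:Z - n%:Z + 2 * i%:Z).
Definition white (n i k : nat) : square := (- k.+1%:Z, k.+1%:Z - n%:Z + 2 * i%:Z).

Lemma mem_removed n I q : reflect
  (exists2 l, (l < n)%N && (l.+1 \notin I) & q = black n 0 l \/ q = mirror (black n 0 l))
  (q \in removed n I).
Proof.
have swE l : sw_square n l.+1 = black n 0 l by congr (_, _); lia.
rewrite /removed in_fsetU; apply: (iffP orP).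
  by case=> /imfsetP[[|l]] /=; rewrite mem_filter mem_iota => /andP[lI ln] ->;
    try lia; exists l; rewrite ?lI ?swE; auto; lia.
case=> l /andP[ln lI] [->|->]; [left|right]; apply/imfsetP; exists l.+1;
  by rewrite /= ?swE // mem_filter mem_iota lI; lia.
Qed.

Lemma region_mirror n I q : (mirror q \in region n I) = (q \in region n I).
Proof.
rewrite /region !in_fsetD !in_aztec.
have mirror_removed p : p \in removed n I -> mirror p \in removed n I.
  move=> /mem_removed[l hl [->|->]]; apply/mem_removed; exists l => //; first by right.
  by left; rewrite mirrorK.
have -> : aztec_cond n (mirror q) = aztec_cond n q.
  by rewrite /aztec_cond /mirror /=; congr (_ <= _); congr (_ + _); lia.
congr (~~ _ && _); apply/idP/idP => /mirror_removed //; by rewrite mirrorK.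
Qed.

Lemma region_black n I i k : (i + k < n)%N ->
  (black n i k \in region n I) = ((i == 0%N) ==> (k.+1 \in I)).
Proof.
move=> ikn; rewrite /region in_fsetD in_aztec.
have -> : aztec_cond n (black n i k) by rewrite /aztec_cond /=; lia.
rewrite andbT -[RHS]negbK; congr (~~ _); apply/mem_removed/idP.
  move=> [l /andP[_ lI]] [] [] *; last by lia.
  by have [-> ->] : i = 0%N /\ k = l by lia.
case: i ikn => //= ikn kI; exists k; last by left.
by rewrite kI andbT; lia.
Qed.

Lemma region_white n I i k : (i + k < n)%N -> white n i k \in region n I.
Proof.
move=> ikn; rewrite /region in_fsetD in_aztec.
have -> : aztec_cond n (white n i k) by rewrite /aztec_cond /=; lia.
by rewrite andbT; apply/mem_removed => -[l _] [] []; lia.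
Qed.

Lemma left_regionP n I q : q \in region n I -> q.1 < 0 ->
  exists i k, (i + k < n)%N /\ (q = black n i k \/ q = white n i k).
Proof.
rewrite /region in_fsetD in_aztec => /andP[_]; case: q => a b.
rewrite /aztec_cond /= => ab a0.
(* The sum [b + n + a + 1] is [2i] on [black n i k] and [2i + 1] on [white n i k]. *)
exists (absz (b + n%:Z + a + 1))./2, (absz (a + 1)).
split; first by lia.
have [ev|od] := boolP (odd (absz (b + n%:Z + a + 1))); [right|left];
  congr (_, _); lia.
Qed.

Local Open Scope fset_scope.
Local Open Scope ring_scope.

Definition edge (T : {fset {fset square}}) (q : square) (d : dir) : bool :=
  [fset q; step d q] \in T.

Lemma edge_opp T q d : edge T (step d q) (opp_dir d) = edge T q d.
Proof. by rewrite /edge step_opp fsetUC. Qed.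

Lemma fset2_inj (K : choiceType) (x y z : K) :
  y != x -> [fset x; y] = [fset x; z] -> y = z.
Proof.
move=> yx /fsetP/(_ y); rewrite !inE eqxx orbT (negPf yx) /=.
by move=> /esym/eqP.
Qed.

Section Tiling.
Variables (U : {fset square}) (T : {fset {fset square}}).
Hypothesis T_tiling : is_tiling U T.

Lemma tiling_domino D : D \in T -> exists q d, D = [fset q; step d q].
Proof.
case/and3P: T_tiling => /forallP dT _ _ DT.
have /is_dominoP[p [q [/adjacentP[d ->] /= ->]]] := dT [` DT].
by exists p, d.
Qed.

Lemma tiling_mem D q : D \in T -> q \in D -> q \in U.
Proof.
case/and3P: T_tiling => _ _ /eqP <- DT qD.
by apply/bigfcupP; exists D; rewrite ?DT.
Qed.

Lemma tiling_uniq D D' q : D \in T -> D' \in T -> q \in D -> q \in D' -> D = D'.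
Proof.
case/and3P: T_tiling => _ /trivIfsetP tT _ DT D'T qD qD'.
apply/eqP/negP => /negP neq; have /fdisjointP/(_ q qD) := tT _ _ DT D'T neq.
by rewrite qD'.
Qed.

Lemma edge_mem q d : edge T q d -> q \in U.
Proof. by move/tiling_mem; apply; rewrite !inE eqxx. Qed.

Lemma edge_exists q : q \in U -> exists d, edge T q d.
Proof.
case/and3P: (T_tiling) => _ _ /eqP <- /bigfcupP[D /andP[DT _] qD].
have [p [d eD]] := tiling_domino DT.
move: qD; rewrite eD !inE => /orP[] /eqP ->.
  by exists d; rewrite /edge -eD.
by exists (opp_dir d); rewrite edge_opp /edge -eD.
Qed.

Lemma edge_inj q d d' : edge T q d -> edge T q d' -> d = d'.
Proof.
move=> h h'; apply: (@step_inj q) => /=; apply: fset2_inj (step_neq _ _) _.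
exact: tiling_uniq h h' (fset21 _ _) (fset21 _ _).
Qed.

End Tiling.

(** The default agrees with the convention that removed squares point down. *)
Definition direction (T : {fset {fset square}}) (q : square) : dir :=
  head (false, true) [seq d <- dirs | edge T q d].

Lemma edge_direction U T q d : is_tiling U T ->
  edge T q d = (q \in U) && (d == direction T q).
Proof.
move=> tT; have [qU|qU] := boolP (q \in U); last first.
  by apply/negP => /(edge_mem tT); apply/negP.
have [d0 e0] := edge_exists tT qU.
have eE d' : edge T q d' = (d' == d0).
  by apply/idP/eqP => [e|->] //; apply: (edge_inj tT) e e0.
rewrite eE /direction (eq_filter eE) {e0 eE}.

by case: d0 => [[] []].
Qed.

Lemma direction_out U T q : is_tiling U T -> q \notin U -> direction T q = (false, true).
Proof.
move=> tT qU; rewrite /direction (@eq_filter _ _ pred0) ?filter_pred0 // => d.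
by rewrite (edge_direction _ _ tT) (negPf qU).
Qed.

Lemma tiling_eq U T T' : is_tiling U T -> is_tiling U T' ->
  {in U, direction T =1 direction T'} -> T = T'.
Proof.
move=> tT tT' eT; apply/fsetP => D.
wlog suff sub : T T' tT tT' eT / D \in T -> D \in T'.
  by apply/idP/idP; apply: sub => // q qU; rewrite eT.
move=> DT; have [q [d eD]] := tiling_domino tT DT; rewrite eD in DT *.
have : edge T q d by []; rewrite -/(edge T' q d).
rewrite (edge_direction _ _ tT) (edge_direction _ _ tT') => /andP[qU /eqP->].
by rewrite qU eT ?eqxx.
Qed.

Definition dominoes (U : {fset square}) (delta : square -> dir) :=
  [fset [fset q; step (delta q) q] | q in U].

Section Dominoes.
Variables (U : {fset square}) (delta : square -> dir).
Hypothesis delta_mem : forall q, q \in U -> step (delta q) q \in U.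
Hypothesis delta_opp : forall q, q \in U -> delta (step (delta q) q) = opp_dir (delta q).

Lemma mem_dominoes D q : D \in dominoes U delta -> q \in D ->
  q \in U /\ D = [fset q; step (delta q) q].
Proof.
case/imfsetP => p /= pU ->; rewrite !inE => /orP[] /eqP -> //.
by rewrite delta_mem // delta_opp // step_opp fsetUC.
Qed.

Lemma dominoes_tiling : is_tiling U (dominoes U delta).
Proof.
apply/and3P; split.
- apply/forallP => -[D /= DT]; case/imfsetP: (DT) => q /= qU ->.
  by apply/is_dominoP; exists q, (step (delta q) q); split=> //; apply/adjacentP; exists (delta q).
- apply/trivIfsetP => D D' DT D'T; apply: contraNT.
  rewrite -fsetI_eq0 => /fset0Pn[q /fsetIP[qD qD']]; apply/eqP.
  by have [_ ->] := mem_dominoes DT qD; have [_ ->] := mem_dominoes D'T qD'.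
- apply/eqP/fsetP => q; apply/bigfcupP/idP => [[D /andP[DT _]]|qU].
    by case/(mem_dominoes DT).
  exists [fset q; step (delta q) q]; last by rewrite !inE eqxx.
  by rewrite andbT; apply/imfsetP; exists q.
Qed.

Lemma edge_dominoes q d : edge (dominoes U delta) q d = (q \in U) && (d == delta q).
Proof.
apply/idP/andP => [h|[qU /eqP ->]]; last by apply/imfsetP; exists q.
have [qU e] := mem_dominoes h (fset21 _ _); split=> //.
by apply/eqP/(@step_inj q)/(fset2_inj (step_neq _ _) e).
Qed.

Lemma direction_dominoes q : q \in U -> direction (dominoes U delta) q = delta q.
Proof.
move=> qU; apply/esym/eqP.
by have := edge_direction q (delta q) dominoes_tiling; rewrite edge_dominoes qU eqxx.
Qed.

End Dominoes.

Lemma mirror_domino q d :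
  [fset mirror p | p in [fset q; step d q]] = [fset mirror q; step (mirror_dir d) (mirror q)].
Proof.
rewrite step_mirror; apply/fsetP => p.
apply/imfsetP/fset2P => [[p' /fset2P[] -> ->]|[] ->]; [by left|by right| |].
  by exists q => //; apply: fset21.
by exists (step d q) => //; apply: fset22.
Qed.

Lemma reflection_invariantP U T : is_tiling U T ->
  reflect (forall q d, edge T (mirror q) (mirror_dir d) = edge T q d)
          (reflection_invariant T).
Proof.
move=> tT; apply: (iffP eqP) => [iT q d|sT].
  have sub p e : edge T p e -> edge T (mirror p) (mirror_dir e).
    by move=> pe; rewrite /edge -mirror_domino -[in X in _ \in X]iT; apply: in_imfset.
  by apply/idP/idP => /sub //; rewrite mirrorK mirror_dirK.
apply/fsetP => D; apply/imfsetP/idP => [[D' /= D'T ->]|DT].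
  have [q [d eD]] := tiling_domino tT D'T.
  by have := sT q d; rewrite eD mirror_domino /edge -eD D'T.
have [q [d eD]] := tiling_domino tT DT.
exists [fset mirror q; step (mirror_dir d) (mirror q)] => /=.
  by have := sT q d; rewrite /edge -eD DT.
have := mirror_domino (mirror q) (mirror_dir d).
by rewrite mirrorK mirror_dirK -eD => /esym.
Qed.

Lemma diag_cellE n i : diag_cell n i.+1 =
  [fset black n i 0; mirror (white n i 0); white n i 0; mirror (black n i 0)].
Proof.
rewrite /diag_cell.
have -> : black n i 0 = (- 1, 2 * i.+1%:Z - n%:Z - 2) by congr (_, _); lia.
have -> : white n i 0 = (- 1, 2 * i.+1%:Z - n%:Z - 1) by congr (_, _); lia.
by [].
Qed.

Lemma cell_domino n i q d :
    [|| q == black n i 0, q == mirror (white n i 0), q == white n i 0 |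
        q == mirror (black n i 0)] ->
    [|| step d q == black n i 0, step d q == mirror (white n i 0),
        step d q == white n i 0 | step d q == mirror (black n i 0)] ->
  exists x y, [fset q; step d q] = [fset x; y] /\
    (x, y) \in [:: (black n i 0, white n i 0);
      (mirror (black n i 0), mirror (white n i 0));
      (black n i 0, mirror (black n i 0)); (white n i 0, mirror (white n i 0))].
Proof.
rewrite (_ : black n i 0 = (- 1, 2 * i%:Z - n%:Z)); last by congr (_, _); lia.
rewrite (_ : white n i 0 = (- 1, 2 * i%:Z - n%:Z + 1)); last by congr (_, _); lia.
(* Only the height [c] of the block matters; the rest is a finite check. *)
move: (2 * i%:Z - n%:Z) => c; rewrite /mirror /= opprK subrr => qc sc.
have eE (z t : square) : (z == t) = (z.1 == t.1) && (z.2 == t.2) by case: z t => ? ? [].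
rewrite !eE /= in qc sc.
case: q d qc sc => x y [[] []] /= qc sc.
- exists (x, c), (x, c + 1); split; last by rewrite !inE !xpair_eqE; lia.
  by rewrite (_ : y = c) //; lia.
- exists (-1, y), (0, y); split; last by rewrite !inE !xpair_eqE; lia.
  by rewrite (_ : x = -1) //; lia.
- exists (x, c), (x, c + 1); split; last by rewrite !inE !xpair_eqE; lia.
  by rewrite fsetUC (_ : y = c + 1) ?addrK //; lia.
- exists (-1, y), (0, y); split; last by rewrite !inE !xpair_eqE; lia.
  by rewrite fsetUC (_ : x = 0) //; lia.
Qed.

(** By symmetry the two vertical dominoes of a cell occur together, so a single domino must be one
    of the two horizontal ones. *)
Lemma diag_cell_card n U T i : is_tiling U T -> reflection_invariant T ->
  (#|` [fset D in T | D `<=` diag_cell n i.+1]| == 1%N) =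
  ~~ edge T (black n i 0) (true, true) &&
    (edge T (black n i 0) (true, false) (+) edge T (white n i 0) (true, false)).
Proof.
move=> tT /(reflection_invariantP tT) sT; rewrite diag_cellE.
set b := black n i 0; set w := white n i 0.
set C := [fset D in T | _].
pose Du := [fset b; w]; pose Db := [fset b; mirror b]; pose Dw := [fset w; mirror w].
have eu : step (true, true) b = w by congr (_, _); rewrite /=; lia.
have eb : step (true, false) b = mirror b by congr (_, _); rewrite /=; lia.
have ew : step (true, false) w = mirror w by congr (_, _); rewrite /=; lia.
have em : step (true, true) (mirror b) = mirror w by rewrite -eu -step_mirror.
have inC D : (D \in C) = (D \in T) && (D `<=` [fset b; mirror w; w; mirror b]).
  by rewrite !inE.
have bw : (b == w) = false by apply/eqP => -[]; lia.
have bmw : (b == mirror w) = false by apply/eqP => -[]; lia.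
have bmb : (b == mirror b) = false by apply/eqP => -[]; lia.
have uC : (Du \in C) = edge T b (true, true).
  by rewrite inC /edge eu fsubUset !fsub1set !inE !eqxx /= ?orbT ?andbT.
have mC : ([fset mirror b; mirror w] \in C) = edge T b (true, true).
  by rewrite inC -[RHS]sT /edge em fsubUset !fsub1set !inE !eqxx /= ?orbT ?andbT.
have bC : (Db \in C) = edge T b (true, false).
  by rewrite inC /edge eb fsubUset !fsub1set !inE !eqxx /= ?orbT ?andbT.
have wC : (Dw \in C) = edge T w (true, false).
  by rewrite inC /edge ew fsubUset !fsub1set !inE !eqxx /= ?orbT ?andbT.
have classify D : D \in C -> [\/ D = Du, D = [fset mirror b; mirror w], D = Db | D = Dw].
  rewrite inC => /andP[/(tiling_domino tT)[q [d ->]]].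
  rewrite fsubUset !fsub1set !inE -!orbA => /andP[qc sc].
  have [x [y [->]]] := cell_domino qc sc.
  rewrite !inE => /or4P[] /eqP[-> ->]; [by constructor 1 | by constructor 2 |
    by constructor 3 | by constructor 4].
have two D D' : D \in C -> D' \in C -> D != D' -> (#|` C| == 1%N) = false.
  move=> DC D'C neq; apply/negbTE; rewrite neq_ltn; apply/orP; right.
  have -> : 1%N.+1 = #|` [fset D; D']| by rewrite cardfs2 neq.
  by apply: fsubset_leq_card; rewrite fsubUset !fsub1set DC.
have neqD (D D' : {fset square}) q : q \in D -> q \notin D' -> D != D'.
  by move=> qD; apply: contraNneq => <-.
have [u|u] := boolP (edge T b (true, true)).
  rewrite u in uC mC; apply: (two _ _ uC mC).
  by apply: (neqD _ _ b); rewrite !inE ?eqxx // bmb bmw.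
have only D0 : D0 \in C -> (forall D, D \in C -> D = D0) -> #|` C| == 1%N.
  move=> D0C D0u; rewrite (_ : C = [fset D0]) ?cardfs1 //.
  by apply/fsetP => D; rewrite in_fset1; apply/idP/eqP => [/D0u|->].
rewrite (negPf u) in uC mC.
have [eb'|eb'] := boolP (edge T b (true, false));
  have [ew'|ew'] := boolP (edge T w (true, false)); rewrite /= ?(negPf eb') ?(negPf ew').
- rewrite eb' in bC; rewrite ew' in wC; apply: (two _ _ bC wC).
  by apply: (neqD _ _ b); rewrite !inE ?eqxx // bw bmw.
- rewrite eb' in bC; rewrite (negPf ew') in wC; apply: (only Db) => // D DC.
  by case: (classify D DC) => eD //; move: DC; rewrite eD ?uC ?mC ?wC.
- rewrite (negPf eb') in bC; rewrite ew' in wC; apply: (only Dw) => // D DC.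
  by case: (classify D DC) => eD //; move: DC; rewrite eD ?uC ?mC ?bC.
- rewrite (negPf eb') in bC; rewrite (negPf ew') in wC.
  rewrite (_ : C = fset0) ?cardfs0 //; apply/fsetP => D; rewrite in_fset0.
  by apply/negP => DC; case: (classify D DC) => eD; move: DC; rewrite eD ?uC ?mC ?bC ?wC.
Qed.

(** * Directions of the black squares of the left half *)

(* The default value makes every test for right, down or left fail outside the left half. *)
Definition dir_at (X : seq (seq dir)) (i k : nat) : dir :=
  nth (true, true) (nth [::] X i) k.

(** For [k = 0] the domino joining the white square to its mirror image counts as the hit; in an
    off-diagonally symmetric tiling it occurs exactly when the innermost black square does not go
    right. *)
Definition own_hit (d : nat -> nat -> dir) (i k : nat) : bool :=
  if k is 0 then ~~ (d i 0%N).1 else d i k == (true, true).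

(** The summands stand for the neighbours below, left, above and right; for [k = 0] the last is the
    mirror image, left to [own_hit]. *)
Definition hit_once (d : nat -> nat -> dir) (i k : nat) : bool :=
  (own_hit d i k + (d i k.+1 == (true, false)) + (d i.+1 k == (false, true))
     + ((0 < k) && (d i.+1 k.-1 == (false, false))) == 1)%N.

Definition white_dir (d : nat -> nat -> dir) (i k : nat) : dir :=
  if own_hit d i k then (if k is 0 then (true, false) else (false, true))
  else if d i k.+1 == (true, false) then (false, false)
  else if d i.+1 k == (false, true) then (true, true)
  else (true, false).

(** In the first row, squares that are present have no neighbour below or to the left, and the
    second clause of [rule_start] makes the removed ones point down. *)
Record local_rules (n : nat) (I : seq nat) (d : nat -> nat -> dir) : Prop := LocalRules {
  rule_start : forall k, (k < n)%N ->
    (d 0%N k).1 = (k.+1 \in I) /\ (d 0%N k).1 || (d 0%N k).2;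
  rule_diag : forall i, (i < n)%N -> d i 0%N != (true, true);
  rule_hit : forall i k, (i + k < n)%N -> hit_once d i k }.

Definition encode (n : nat) (T : {fset {fset square}}) : seq (seq dir) :=
  [seq [seq direction T (black n i k) | k <- iota 0 (n - i)] | i <- iota 0 n].

Lemma dir_at_encode n T i k : dir_at (encode n T) i k =
  if (i + k < n)%N then direction T (black n i k) else (true, true).
Proof.
rewrite /dir_at /encode; case: ifP => ikn.
  by rewrite (nth_map 0%N) ?size_iota ?(nth_map 0%N) ?size_iota ?nth_iota //; lia.
have [ni|ni] := ltnP i n; last by rewrite [nth [::] _ _]nth_default ?nth_nil // size_map size_iota.
rewrite (nth_map 0%N) ?size_iota // nth_default // size_map size_iota nth_iota //; lia.
Qed.

Lemma step_black_up n i k : step (true, true) (black n i k) = white n i k.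
Proof. by congr (_, _); rewrite /=; lia. Qed.
Lemma step_black_right n i k : step (true, false) (black n i k.+1) = white n i k.
Proof. by congr (_, _); rewrite /=; lia. Qed.
Lemma step_black_down n i k : step (false, true) (black n i.+1 k) = white n i k.
Proof. by congr (_, _); rewrite /=; lia. Qed.
Lemma step_black_left n i k : step (false, false) (black n i.+1 k) = white n i k.+1.
Proof. by congr (_, _); rewrite /=; lia. Qed.
Lemma step_black_center n i : step (true, false) (black n i 0) = mirror (black n i 0).
Proof. by congr (_, _); rewrite /=; lia. Qed.
Lemma step_white_center n i : step (true, false) (white n i 0) = mirror (white n i 0).
Proof. by congr (_, _); rewrite /=; lia. Qed.

Lemma edge_black_white T n i k d w : step d (black n i k) = w ->
  edge T (black n i k) d = edge T w (opp_dir d).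
Proof. by move=> <-; rewrite edge_opp. Qed.

Lemma white_left_out n I i k : (i + k).+1 = n ->
  step (false, false) (white n i k) \notin region n I.
Proof.
by move=> ikn; rewrite /region in_fsetD in_aztec negb_and /aztec_cond /=; lia.
Qed.

Lemma white_up_out n I i k : (i + k).+1 = n ->
  step (true, true) (white n i k) \notin region n I.
Proof.
by move=> ikn; rewrite /region in_fsetD in_aztec negb_and /aztec_cond /=; lia.
Qed.

Lemma black0_down_out n I k : step (false, true) (black n 0 k) \notin region n I.
Proof. by rewrite /region in_fsetD in_aztec negb_and /aztec_cond /=; lia. Qed.

Lemma black0_left_out n I k : step (false, false) (black n 0 k) \notin region n I.
Proof. by rewrite /region in_fsetD in_aztec negb_and /aztec_cond /=; lia. Qed.

(** * From tilings to direction triangles *)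

Section Encode.
Variables (n : nat) (I : seq nat) (T : {fset {fset square}}).
Hypotheses (tT : is_tiling (region n I) T) (mT : reflection_invariant T).
Hypothesis oT : off_diagonal n T.
Let d := dir_at (encode n T).

(** A removed square lies on no domino although its direction is down by default, whence the
    exclusion of down in the first row. *)
Lemma edge_black i k e : (i + k < n)%N -> (0 < i)%N || (e != (false, true)) ->
  edge T (black n i k) e = (d i k == e).
Proof.
move=> ikn ie; rewrite /d dir_at_encode ikn (edge_direction _ _ tT) eq_sym.
have [//|bU] := boolP (black n i k \in _).
rewrite (direction_out tT bU) /= eq_sym; apply/esym/negbTE.
by move: bU ie; rewrite region_black //; case: (i).
Qed.

Lemma edge_white i k e : (i + k < n)%N ->
  edge T (white n i k) e = (direction T (white n i k) == e).
Proof. by move=> ikn; rewrite (edge_direction _ _ tT) region_white //= eq_sym. Qed.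

Lemma edge_out q e : step e q \notin region n I -> edge T q e = false.
Proof.
by move=> out; apply: contraNF out; rewrite -edge_opp => /(edge_mem tT).
Qed.

Lemma diag_rule i : (i < n)%N -> ~~ edge T (black n i 0) (true, true) &&
    (edge T (black n i 0) (true, false) (+) edge T (white n i 0) (true, false)).
Proof.
move=> ni; rewrite -(diag_cell_card _ _ tT mT).
by move/allP: oT; apply; rewrite mem_iota; lia.
Qed.

Lemma encode_diag i : (i < n)%N -> d i 0%N != (true, true).
Proof.
by move=> ni; case/andP: (diag_rule ni); rewrite edge_black ?addn0 ?orbT.
Qed.

Lemma encode_hits i k : (i + k < n)%N ->
  [/\ own_hit d i k = (direction T (white n i k) == if k is 0 then (true, false) else (false, true)),
      (d i k.+1 == (true, false)) = (direction T (white n i k) == (false, false)),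
      (d i.+1 k == (false, true)) = (direction T (white n i k) == (true, true)) &
      if k is k'.+1
      then (d i.+1 k' == (false, false)) = (direction T (white n i k) == (true, false))
      else direction T (white n i k) != (false, true)].
Proof.
move=> ikn; split.
- case: k ikn => [|k] ikn; rewrite -edge_white //= -/(d i 0%N).
    (* Exactly one of the two horizontal dominoes of the cell is present. *)
    rewrite addn0 in ikn; case/andP: (diag_rule ikn).
    rewrite !edge_black ?addn0 ?orbT //.
    by case: (d i 0%N) => [] [] []; case: (edge T (white _ _ _) _).
  by rewrite -edge_black ?orbT // (edge_black_white T (step_black_up _ _ _)).
- rewrite -edge_white //; have [ikn'|ikn'] := ltnP (i + k.+1) n.
    by rewrite -edge_black ?orbT // (edge_black_white T (step_black_right _ _ _)).
  (* At the end of the row the neighbour is outside the region, and the default of [dir_at] fails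
     the test. *)
  rewrite edge_out ?white_left_out //; last by lia.
  by rewrite /d dir_at_encode ltnNge ikn'.
- rewrite -edge_white //; have [ikn'|ikn'] := ltnP (i.+1 + k) n.
    by rewrite -edge_black // (edge_black_white T (step_black_down _ _ _)).
  rewrite edge_out ?white_up_out //; last by lia.
  by rewrite /d dir_at_encode ltnNge ikn'.
- case: k ikn => [|k] ikn; rewrite -edge_white //.
    rewrite addn0 in ikn; case/andP: (diag_rule ikn).
    by rewrite (edge_black_white T (step_black_up _ _ _)).
  by rewrite -edge_black -?(edge_black_white T (step_black_left _ _ _)) //; lia.
Qed.

Lemma encode_white i k : (i + k < n)%N ->
  direction T (white n i k) = white_dir d i k.
Proof.
move=> ikn; have [] := encode_hits ikn; rewrite /white_dir => -> -> -> h.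
by case: k ikn h => [|k] ikn; case: (direction T _) => [[] []].
Qed.

Lemma encode_rules : local_rules n I d.
Proof.
split.
- move=> k kn; rewrite -[k.+1 \in I]/((0 == 0)%N ==> (k.+1 \in I)) -(@region_black n I 0) //.
  have [bU|bU] := boolP (_ \in region n I); last first.
    by rewrite /d dir_at_encode kn (direction_out tT bU).
  have eb e : edge T (black n 0 k) e = (d 0%N k == e).
    by rewrite (edge_direction _ _ tT) bU eq_sym /d dir_at_encode kn.
  have := eb (false, true); have := eb (false, false).
  rewrite !edge_out ?black0_down_out ?black0_left_out //.
  by case: (d 0%N k) => [[] []].
- exact: encode_diag.
- move=> i k ikn; have [] := encode_hits ikn; rewrite /hit_once => -> -> ->.
  by case: k ikn => [|k] ikn => [|/= ->]; case: (direction T _) => [[] []].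
Qed.
End Encode.

(** * From direction triangles to tilings *)

Section Decode.
Variables (n : nat) (I : seq nat) (d : nat -> nat -> dir).
Hypothesis d_rules : local_rules n I d.
Hypothesis d_out : forall i k, (n <= i + k)%N -> d i k = (true, true).

(** In the left half [t] is [2i] on [black n i k] and [2i + 1] on [white n i k]; the right half
    follows by reflection. *)
Definition decode (q : square) : dir :=
  let left_dir p :=
    let k := absz (p.1 + 1) in
    let t := absz (p.2 - k%:Z + n%:Z) in
    if odd t then white_dir d t./2 k else d t./2 k in
  if q.1 < 0 then left_dir q else mirror_dir (left_dir (mirror q)).

Lemma decode_black i k : decode (black n i k) = d i k.
Proof.
rewrite /decode; have -> : (black n i k).1 < 0 by rewrite /=; lia.
have -> : absz ((black n i k).1 + 1) = k by rewrite /=; lia.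
have -> : absz ((black n i k).2 - k%:Z + n%:Z) = i.*2 by rewrite /=; lia.
by rewrite odd_double doubleK.
Qed.

Lemma decode_white i k : decode (white n i k) = white_dir d i k.
Proof.
rewrite /decode; have -> : (white n i k).1 < 0 by rewrite /=; lia.
have -> : absz ((white n i k).1 + 1) = k by rewrite /=; lia.
have -> : absz ((white n i k).2 - k%:Z + n%:Z) = (i.*2).+1 by rewrite /=; lia.
by rewrite /= odd_double uphalf_double.
Qed.

Lemma decode_mirror q : decode (mirror q) = mirror_dir (decode q).
Proof.
rewrite /decode mirrorK /=; have [q0|q0] := ltrP q.1 0.
  by have -> : (- q.1 - 1 < 0) = false by lia.
by have -> : - q.1 - 1 < 0; [lia|rewrite mirror_dirK].
Qed.

Lemma in_range i k : d i k != (true, true) -> (i + k < n)%N.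
Proof. by rewrite ltnNge; apply: contraNN => /d_out ->. Qed.

Lemma present_black i k : (i + k < n)%N -> (0 < i)%N || (d i k).1 ->
  black n i k \in region n I.
Proof.
move=> ikn; rewrite region_black //; case: i ikn => //= ikn.
by rewrite (rule_start d_rules ikn).1.
Qed.

Let coherent q :=
  step (decode q) q \in region n I /\ decode (step (decode q) q) = opp_dir (decode q).

Lemma coherent_white i k : (i + k < n)%N -> coherent (white n i k).
Proof.
move=> ikn; rewrite /coherent decode_white /white_dir.
have := rule_hit d_rules ikn; rewrite /hit_once.
have [own _|_] := boolP (own_hit d i k).
  case: k ikn own => [|k] ikn own.
    rewrite step_white_center region_mirror region_white // decode_mirror decode_white.
    by rewrite /white_dir own.
  rewrite -step_black_up (step_opp (true, true)) decode_black (eqP own); split=> //.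
  by apply: present_black; rewrite // (eqP own) orbT.
have [rt _|_] := eqVneq (d i k.+1) (true, false).
  have ikn' : (i + k.+1 < n)%N by apply: in_range; rewrite rt.
  rewrite -step_black_right (step_opp (true, false)) decode_black rt; split=> //.
  by apply: present_black; rewrite // rt orbT.
have [dn _|_] := eqVneq (d i.+1 k) (false, true).
  have ikn' : (i.+1 + k < n)%N by apply: in_range; rewrite dn.
  rewrite -step_black_down (step_opp (false, true)) decode_black dn; split=> //.
  exact: present_black.
(* Only the right neighbour remains; for [k = 0] the sum would be 0. *)
case: k ikn => [|k] // ikn sum1.
have lf : d i.+1 k = (false, false) by move: sum1; rewrite /= !add0n eqb1 => /eqP.
have ikn' : (i.+1 + k < n)%N by lia.
rewrite -step_black_left (step_opp (false, false)) decode_black lf; split=> //.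
exact: present_black.
Qed.

(** A white square hit by this black square is hit by no other, so the tests of [white_dir] lead
    back to it. *)
Lemma coherent_black i k : (i + k < n)%N -> black n i k \in region n I ->
  coherent (black n i k).
Proof.
move=> ikn; rewrite region_black // /coherent decode_black => bU.
have start : i = 0%N -> (d i k).1.
  by move=> i0; rewrite i0 in ikn bU *; rewrite (rule_start d_rules ikn).1.
have hit j l : (j + l < n)%N -> hit_once d j l by move=> jl; exact: (rule_hit d_rules jl).
case E: (d i k) start => [[] []] /= start.
- case: k ikn {bU} E => [|k] ikn E.
    by rewrite addn0 in ikn; have := rule_diag d_rules ikn; rewrite E.
  rewrite -[(_, _ : int)]/(step (true, true) (black n i k.+1)).
  rewrite step_black_up region_white // decode_white /white_dir /= E.
  by rewrite eqxx.
- case: k ikn {bU} E => [|k] ikn E.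
    rewrite -[(_, _ : int)]/(step (true, false) (black n i 0)) step_black_center.
    rewrite region_mirror decode_mirror decode_black E region_black //; split=> //.
    by apply/implyP => /eqP i0; move: ikn E; rewrite i0 => ikn E;
       rewrite -(rule_start d_rules ikn).1 E.
  rewrite -[(_, _ : int)]/(step (true, false) (black n i k.+1)).
  have ikn' : (i + k < n)%N by lia.
  rewrite step_black_right region_white // decode_white /white_dir E eqxx.
  by have := hit _ _ ikn'; rewrite /hit_once E; case: (own_hit d i k) => //; lia.
- case: i ikn E start {bU} => [_ _ /(_ erefl) //|i] ikn E _.
  rewrite -[(_, _ : int)]/(step (false, true) (black n i.+1 k)).
  have ikn' : (i + k < n)%N by lia.
  rewrite step_black_down region_white // decode_white /white_dir E eqxx.
  have := hit _ _ ikn'; rewrite /hit_once E eqxx.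
  by case: (own_hit d i k) => //=; case: (d i k.+1 == _) => //=; lia.
- case: i ikn E start {bU} => [_ _ /(_ erefl) //|i] ikn E _.
  rewrite -[(_, _ : int)]/(step (false, false) (black n i.+1 k)).
  have ikn' : (i + k.+1 < n)%N by lia.
  rewrite step_black_left region_white // decode_white /white_dir.
  have := hit _ _ ikn'; rewrite /hit_once /= E eqxx.
  by case: (d i k.+1 == _) => //=; case: (d i k.+2 == _) => //=;
     case: (d i.+1 k.+1 == _) => //=; lia.
Qed.

Lemma coherent_region q : q \in region n I -> coherent q.
Proof.
wlog q0 : q / q.1 < 0.
  move=> left_case qU; have [q0|q0] := ltrP q.1 0; first exact: left_case.
  have mq0 : (mirror q).1 < 0.
    by move: q0; case: (q) => x y /=; lia.
  have mqU : mirror q \in region n I by rewrite region_mirror.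
  have [] := left_case _ mq0 mqU.
  rewrite /coherent decode_mirror step_mirror region_mirror decode_mirror => sU e.
  by split=> //; apply: (can_inj mirror_dirK); rewrite e opp_mirror_dir.
move=> qU; have [i [k [ikn [eq|eq]]]] := left_regionP qU q0; rewrite eq in qU *.
  exact: coherent_black.
exact: coherent_white.
Qed.

Let tiling := dominoes (region n I) decode.

Lemma decode_tiling : is_tiling (region n I) tiling.
Proof.
by apply: dominoes_tiling => q /coherent_region[].
Qed.

Lemma edge_decode q e : edge tiling q e = (q \in region n I) && (e == decode q).
Proof.
by apply: edge_dominoes => p /coherent_region[].
Qed.

Lemma decode_invariant : reflection_invariant tiling.
Proof.
apply/(reflection_invariantP decode_tiling) => q e.
rewrite !edge_decode region_mirror decode_mirror; congr (_ && _).
by rewrite (inj_eq (can_inj mirror_dirK)).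
Qed.

Lemma decode_off_diagonal : off_diagonal n tiling.
Proof.
apply/allP => -[|i]; rewrite mem_iota // => /andP[_ ni].
have {}ni : (i + 0 < n)%N by lia.
rewrite (diag_cell_card _ _ decode_tiling decode_invariant) !edge_decode.
rewrite decode_black decode_white region_white //.
have := rule_diag d_rules (i := i); rewrite -{1}[i]addn0 => /(_ ni).
have [bU|] := boolP (black n i 0 \in _).
  have := rule_hit d_rules ni; rewrite /hit_once /white_dir /=.
  case E: (d i 0%N) => [[] []] //=.
  by case: (d i 1%N == _) => //; case: (d i.+1 0%N == _).
(* A removed innermost square carries no particle, so the white square above it is matched with its
   mirror image. *)
rewrite region_black // negb_imply => /andP[/eqP i0 kI] _.
move: ni kI; rewrite i0 => ni; have [<- _ kI] := rule_start d_rules ni.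
by rewrite /white_dir /= kI.
Qed.

Lemma direction_decode i k : (i + k < n)%N -> direction tiling (black n i k) = d i k.
Proof.
move=> ikn; have [bU|bU] := boolP (black n i k \in region n I).
  by rewrite direction_dominoes ?decode_black // => q /coherent_region[].
rewrite (direction_out decode_tiling bU).
move: bU; rewrite region_black // negb_imply => /andP[/eqP i0 kI].
move: ikn kI; rewrite i0 => ikn; have [<- + kI] := rule_start d_rules ikn.
by case: (d 0%N k) kI => [[] []].
Qed.

End Decode.

(** * Counting *)

Lemma cons_triangles n r X :
  (r :: X \in triangles n.+1) = (size r == n.+1) && (X \in triangles n).
Proof.
have ad (t : seq dir) : all (mem dirs) t by apply/allP => -[[] []].
transitivity ((r \in words dirs n.+1) && (X \in triangles n)).
  apply/allpairsP/andP => [[[a b] /= [aw bt [-> ->]]]|[rw Xt]] //.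
  by exists (r, X).
by rewrite mem_words ad andbT.
Qed.

Lemma triangles_uniq n : uniq (triangles n).
Proof.
elim: n => // n IH; apply: allpairs_uniq => //; first exact: words_uniq.
by move=> [a b] [c e] _ _ /= [-> ->].
Qed.

Lemma trianglesP n X : reflect
  (size X = n /\ forall i, (i < n)%N -> size (nth [::] X i) = (n - i)%N) (X \in triangles n).
Proof.
elim: n X => [|n IH] [|r X].
- by rewrite inE; constructor.
- by rewrite inE; constructor => -[].
- rewrite (_ : _ \in _ = false); last by apply/allpairsP => -[[a b] [_ _]].
  by constructor => -[].
rewrite cons_triangles; apply: (iffP andP) => [[/eqP sr /IH[sX Xi]]|[[sX] Xi]].
  by split=> [|[|i]] /=; rewrite ?sX ?subn0 //; apply: Xi.
split; first by rewrite (Xi 0%N) ?subn0.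
by apply/IH; split=> // i ni; apply: (Xi i.+1).
Qed.

Lemma dir_at_out n X i k : X \in triangles n -> (n <= i + k)%N ->
  dir_at X i k = (true, true).
Proof.
case/trianglesP => sX Xi nik; rewrite /dir_at.
have [ni|ni] := ltnP i n; last by rewrite [nth [::] _ _]nth_default ?nth_nil ?sX.
by rewrite nth_default // Xi //; lia.
Qed.

Lemma triangles_eq n X Y : X \in triangles n -> Y \in triangles n ->
  (forall i k, (i + k < n)%N -> dir_at X i k = dir_at Y i k) -> X = Y.
Proof.
case/trianglesP => sX Xi /trianglesP[sY Yi] eXY.
apply: (@eq_from_nth _ [::]) => [|i]; rewrite ?sX ?sY // => ni.
apply: (@eq_from_nth _ (true, true)) => [|k]; rewrite ?Xi ?Yi // => nik.
by apply: eXY; lia.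
Qed.

Lemma encode_triangles n T : encode n T \in triangles n.
Proof.
apply/trianglesP; split=> [|i ni]; first by rewrite size_map size_iota.
by rewrite (nth_map 0%N) ?size_iota // size_map size_iota nth_iota.
Qed.

(** The conditions [hit_once] along one row of white squares, with [r] below and [r2] above; [own]
    and [pend] carry the hits on the first of them from below and from the right. *)
Fixpoint all_hit (own pend : bool) (r r2 : seq dir) : bool :=
  match r, r2 with
  | d :: r', d2 :: r2' =>
      (own + (d == (true, false)) + (d2 == (false, true)) + pend == 1)%N
      && all_hit (d == (true, true)) (d2 == (false, false)) r' r2'
  | [::], [::] => (own + pend == 1)%N
  | _, _ => false
  end.

(** [no_collision] excludes two hits from the own row, [occupied] records a single one, and [covers]
    completes the count to one. *)
Lemma covers_occupied own pend r r2 : size r2 = size r ->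
  no_collision own r && covers pend (occupied own r) r2 = all_hit own pend r r2.
Proof.
elim: r r2 own pend => [|d r IH] [|d2 r2] own pend //= => [_|[sr]].
  by case: own pend => [] [].
rewrite -IH //.
by case: own d pend d2 => [] [[] []] [] [[] []] /=; rewrite ?andbF ?andbT.
Qed.

Lemma all_iota_succ (p : pred nat) m : all p (iota 0 m.+1) = p 0%N && all (p \o S) (iota 0 m).
Proof. by rewrite /= (iotaDl 1 0) all_map. Qed.

Lemma all_hitE own pend r r2 : size r2 = size r -> all_hit own pend r r2 =
  all (fun k => ((if k is k'.+1 then nth (true, true) r k' == (true, true) else own)
         + (nth (true, true) r k == (true, false)) + (nth (true, true) r2 k == (false, true))
         + (if k is k'.+1 then nth (true, true) r2 k' == (false, false) else pend) == 1)%N)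
      (iota 0 (size r).+1).
Proof.
elim: r r2 own pend => [|d r IH] [|d2 r2] own pend // => [_|[sr]].
  by rewrite /= andbT !addn0.
rewrite all_iota_succ [LHS]/= IH //; congr (_ && _).
by apply: eq_all => -[].
Qed.

Definition row_rules (d : nat -> nat -> dir) (m i : nat) : bool :=
  (d i 0%N != (true, true)) && all (hit_once d i) (iota 0 (m - i)).

Lemma row_ok_covers r r2 X : size r = (size r2).+1 ->
  row_ok r && covers false (row_occupied r) r2 = row_rules (dir_at (r :: r2 :: X)) (size r) 0.
Proof.
case: r => // d r [sr]; rewrite /row_ok /row_occupied -andbA covers_occupied // all_hitE //.
rewrite /row_rules subn0 /dir_at; congr (_ && _); apply: eq_all => k.
by rewrite /hit_once /own_hit /dir_at; case: k.
Qed.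

Lemma row_ok_covers_last d : 
  row_ok [:: d] && covers false (row_occupied [:: d]) [::] = row_rules (dir_at [:: [:: d]]) 1 0.
Proof. by case: d => [[] []]. Qed.

(** The conditions are regrouped so that each row of white squares is treated with the black rows
    below and above it. *)
Lemma completes_rules n r X : r :: X \in triangles n.+1 ->
  row_ok r && completes (row_occupied r) X =
  all (row_rules (dir_at (r :: X)) n.+1) (iota 0 n.+1).
Proof.
elim: n r X => [|n IH] r X; rewrite cons_triangles => /andP[/eqP sr XT].
  move: XT; rewrite inE => /eqP ->; case: r sr => // d [] // _.
  by rewrite [iota _ _]/= all_seq1 -row_ok_covers_last.
case: X XT => [|r2 X] XT.
  by case/trianglesP: XT.
have := XT; rewrite cons_triangles => /andP[/eqP sr2 _].
rewrite all_iota_succ.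
have -> : all (row_rules (dir_at (r :: r2 :: X)) n.+2 \o S) (iota 0 n.+1) =
    row_ok r2 && completes (row_occupied r2) X.
  by rewrite (IH _ _ XT); apply: eq_all.
have szr : size r = (size r2).+1 by rewrite sr sr2.
by have := row_ok_covers X szr; rewrite sr => <-; rewrite -andbA.
Qed.

Lemma startsE s r : size r = size s -> starts s r =
  all (fun k => ((nth (true, true) r k).1 == nth false s k) &&
         ((nth (true, true) r k).1 || (nth (true, true) r k).2)) (iota 0 (size s)).
Proof.
elim: s r => [|b s IH] [|d r] // [sr].
by rewrite all_iota_succ [LHS]/= IH // -andbA.
Qed.

Lemma completes_from_rules n I X : (0 < n)%N -> X \in triangles n ->
  reflect (local_rules n I (dir_at X))
          (completes_from [seq k.+1 \in I | k <- iota 0 n] X).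
Proof.
case: n => // n _; case: X => [|r X] XT; first by case/trianglesP: XT.
have sr : size r = n.+1 by move: XT; rewrite cons_triangles => /andP[/eqP].
set s := [seq _ | _ <- _].
rewrite -[completes_from _ _]/[&& starts s r, row_ok r & completes (row_occupied r) X].
rewrite (completes_rules XT) startsE ?size_map ?size_iota //.
have nthI k : (k < n.+1)%N -> nth false [seq k.+1 \in I | k <- iota 0 n.+1] k = (k.+1 \in I).
  by move=> kn; rewrite (nth_map 0%N) ?size_iota // nth_iota.
apply: (iffP andP) => [[/allP st /allP ru]|[st di hi]].
  have ru' i : (i < n.+1)%N -> row_rules (dir_at (r :: X)) n.+1 i.
    by move=> ni; apply: ru; rewrite mem_iota.
  split=> [k kn|i /ru'/andP[]//|i k ikn].
    by have := st k; rewrite mem_iota nthI // => /(_ kn)/andP[/eqP-> ->].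
  have /ru'/andP[_ /allP] : (i < n.+1)%N by lia.
  by apply; rewrite mem_iota; lia.
split; apply/allP => i; rewrite mem_iota /= add0n => ni.
  by have [e1 e2] := st _ ni; rewrite nthI // -e1 e2 eqxx.
rewrite /row_rules di //; apply/allP => k; rewrite mem_iota => kn.
by apply: hi; lia.
Qed.

(** [encode] is a bijection: the black squares of the left half determine its white squares, the
    reflection gives the right half, and [decode] reaches every triangle obeying the rules. *)
Lemma card_off_tilings n I : (0 < n)%N ->
  #|` off_tilings n I| = count (completes_from [seq k.+1 \in I | k <- iota 0 n]) (triangles n).
Proof.
move=> n0; rewrite -size_filter.
have inO T : T \in off_tilings n I ->
    [/\ is_tiling (region n I) T, reflection_invariant T & off_diagonal n T].
  by rewrite in_off_tilings => /and3P[].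
have enc_inj : {in off_tilings n I &, injective (encode n)}.
  move=> T T' /inO[tT mT oT] /inO[tT' mT' oT'] eX.
  have ed i k : (i + k < n)%N -> direction T (black n i k) = direction T' (black n i k).
    by move=> ikn; have := dir_at_encode n T i k; rewrite eX dir_at_encode ikn.
  have left_eq q : q \in region n I -> q.1 < 0 -> direction T q = direction T' q.
    move=> qU q0; have [i [k [ikn [->|->]]]] := left_regionP qU q0; first exact: ed.
    by rewrite (encode_white tT mT oT ikn) (encode_white tT' mT' oT' ikn) eX.
  have dir_mirror T1 q : is_tiling (region n I) T1 -> reflection_invariant T1 ->
      q \in region n I -> direction T1 (mirror q) = mirror_dir (direction T1 q).
    move=> t1 /(reflection_invariantP t1)/(_ q (direction T1 q)) + qU.
    by rewrite !(edge_direction _ _ t1) region_mirror qU eqxx => /= /eqP.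
  apply: (tiling_eq tT tT') => q qU; have [q0|q0] := ltrP q.1 0; first exact: left_eq.
  apply: (can_inj mirror_dirK); rewrite -!dir_mirror //.
  apply: left_eq; rewrite ?region_mirror //.
  by move: q0; case: (q) => x y /=; lia.
have -> : #|` off_tilings n I| = size [seq encode n T | T <- off_tilings n I].
  by rewrite size_map.
apply/perm_size/uniq_perm.
- by rewrite map_inj_in_uniq ?fset_uniq.
- by rewrite filter_uniq ?triangles_uniq.
move=> X; rewrite mem_filter; apply/mapP/andP => [[T /inO[tT mT oT] ->]|[XI XT]].
  split; last exact: encode_triangles.
  by apply/completes_from_rules => //; [exact: encode_triangles|exact: encode_rules].
have ru := elimT (completes_from_rules I n0 XT) XI.
have out i k := dir_at_out (i := i) (k := k) XT.
exists (dominoes (region n I) (decode n (dir_at X))).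
  rewrite in_off_tilings; apply/and3P; split.
  - exact: decode_tiling.
  - exact: decode_invariant.
  - exact: decode_off_diagonal.
apply: (triangles_eq XT (encode_triangles _ _)) => i k ikn.
by rewrite dir_at_encode ikn (direction_decode ru).
Qed.

Lemma positions_filter (p : pred nat) k m :
  positions k [seq p i | i <- iota k m] = [seq i <- iota k m | p i].
Proof. by elim: m k => //= m IH k; rewrite IH. Qed.

Lemma positions_predn n I : sorted ltn I -> all (fun i => (1 <= i <= n)%N) I ->
  positions 0 [seq k.+1 \in I | k <- iota 0 n] = map predn I.
Proof.
move=> sI /allP aI; rewrite positions_filter; apply: (irr_sorted_eq ltn_trans ltnn).
- by apply: sorted_filter (iota_ltn_sorted _ _); apply: ltn_trans.
- have hI : all (mem I) I by apply/allP.
  apply: (homo_sorted_in (f := predn) _ hI sI) => i j /aI iI /aI jI /=; lia.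
move=> k; rewrite mem_filter mem_iota; apply/andP/mapP => [[kI _]|[i iI ->]].
  by exists k.+1.
by have := aI _ iI; case: i iI => // i iI; split => //; lia.
Qed.

Theorem theorem1p1 :
  exists A : nat -> nat -> int,
    (forall i j : nat, (1 <= i)%N -> (1 <= j)%N -> A i j = - A j i) /\
    (forall (n : nat) (I : seq nat),
       (1 <= n)%N ->
       sorted ltn I -> all (fun i => (1 <= i <= n)%N) I -> I <> [::] ->
       (#|` off_tilings n I|)%:Z = pf (principal_sub A I)).
Proof.
(* The matrix is indexed from 1, the positions from 0. *)
exists (fun i j => coupling i.-1 j.-1); split=> [i j _ _|n I n0 sI aI _].
  exact: coupling_antisym.
have sz : size [seq k.+1 \in I | k <- iota 0 n] = n by rewrite size_map size_iota.
rewrite card_off_tilings // -{2}sz count_completes_from ?sz // positions_predn //.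
by rewrite pfaffian_map -(pf_pfaffian 0%N _ (erefl (size I))).
Qed.
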